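(* Let $u, v \ge 1$ be integers with $\gcd(u,v)=1$ and let $\epsilon>0$ be real. Then there is a constant $C = C(v,\epsilon)>0$ such that the following holds. Let $\alpha \in \mathbb{R}\setminus\mathbb{Q}$ and let $H \ge 1$ and $N \ge 1$ be real numbers. Suppose that $a, q \in \mathbb{Z}$ are coprime with $q > N^{1/4}$ and $|\alpha v - a/q| \le 1/q^2$. Set $\mathcal{L}_1 = \log(2HN)$. Then $$\sum_{1 \le h \le H} \left| \sum_{\substack{1 \le n \le N \\ n \equiv u \bmod v}} \Lambda(n)\, e(\alpha h n) \right| \le C\, \mathcal{L}_1^{7} \left( HN q^{-1/2} + H N^{3/4} + H^{1/2} N^{5/6} + (HNq)^{1/2} + (HN)^{\epsilon} q \right),$$ where $h$ and $n$ run over integers.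
   Context: $\Lambda$ denotes the von Mangoldt function, and $e(x) := e^{2\pi i x}$ for real $x$. *)

(* Defs.v *)
From mathcomp Require Import all_boot all_order all_algebra.
From mathcomp Require Import all_classical all_reals all_analysis.
From mathcomp Require Export complex.

Set Implicit Arguments.
Unset Strict Implicit.
Unset Printing Implicit Defensive.

Import Order.TTheory GRing.Theory Num.Theory.

Local Open Scope ring_scope.
Local Open Scope complex_scope.

(* [primes n] is the duplicate-free list of prime divisors of n > 0 (and nil
   for n = 0), so it is a singleton [:: p] exactly when n = p ^ k with p prime
   and k >= 1; see [mangoldt_pow] and [mangoldt_eq0] below. *)
Definition mangoldt (R : realType) (n : nat) : R :=
  if primes n is [:: p] then ln p%:R else 0.

(* e(x) = exp(2 i pi x), by Euler's formula: MathComp-Analysis has no complex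
   exponential. *)
Definition e {R : realType} (x : R) : R[i] :=
  cos (2 * pi * x) +i* sin (2 * pi * x).

Lemma mangoldt_pow (R : realType) (p k : nat) :
  prime p -> mangoldt R (p ^ k.+1) = ln p%:R.
Proof. by move=> pp; rewrite /mangoldt primesX// primes_prime. Qed.

Lemma mangoldt_eq0 (R : realType) (n : nat) :
  (forall p k : nat, prime p -> n <> (p ^ k.+1)%N) -> mangoldt R n = 0.
Proof.
move=> nP; rewrite /mangoldt.
case E: (primes n) => [//|p [|//]].
have : p \in primes n by rewrite E mem_head.
rewrite mem_primes => /and3P[pp n0 pn].
have pnat : p.-nat n.
  by apply/pnatP => // r rp rn; have := mem_primes r n; rewrite rp n0 rn E inE.
have := part_pnat_id pnat; rewrite p_part => nE.
case: (nP p (logn p n).-1 pp); rewrite prednK ?nE//.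
by rewrite logn_gt0 E mem_head.
Qed.

(* Main.v *)
Require Import Defs.
From mathcomp Require Import all_boot all_order all_algebra.
From mathcomp Require Import all_classical all_reals all_analysis.
From mathcomp Require Import ring lra zify.

(** Vinogradov's method in Vaughan's form, with the outer sum over h used to gain.

    Let beta = alpha v, close to a / q.  A sum of e (theta n) over an interval, cut by
    any condition of period v in n, is at most 4 v times
    kappa (D, delta (v theta)), a version of min (D, 1 / |1 - e (v theta)|)
    ([periodic_exp_sum]); so the congruence n = u mod v costs a constant and replaces
    alpha by beta.  Any q / 2 consecutive multiples of beta are separated by
    1 / (2 q) modulo 1, which bounds sums of kappa over multiples of beta
    ([sum_kappa_le], [sum_kappa_hyperbola]).

    Vaughan's identity with both parameters at y, about N ^ (1 / 3), writes the sum of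
    Lambda (n) e (alpha h n) as a short sum, linear sums and bilinear sums
    ([vaughan]).

    In a linear sum a variable m <= y is followed by a long smooth variable.
    Summing the latter leaves kappa at beta h m.  Grouping k = h m gives the weight
    tau (k), which Cauchy-Schwarz separates from kappa at the cost of logarithms only
    ([typeI_kappa_sum]).

    In a bilinear sum both variables are at most about N ^ (2 / 3), and
    one of them, m, is at most N ^ (1 / 2).  Cauchy-Schwarz is applied over the other
    variable n ~ D with the sum over h kept inside, together with the sum over m
    ([typeII_block]).  The diagonal gives (H N D) ^ (1 / 2) <= H ^ (1 / 2) N ^ (5 / 6); off
    the diagonal the frequencies are multiples of beta by differences of integers up
    to H M, and give H N q ^ (- 1 / 2), H (N M) ^ (1 / 2) <= H N ^ (3 / 4) and
    (H N q) ^ (1 / 2).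

    The powers of the logarithm come from mean squares of divisor functions
    ([sq_divisor_sum_le]); the worst case is that of the ternary divisor function in
    [typeII_sum], where 11 / 2 logarithms come from the averages and one from the dyadic
    splitting, hence the exponent 7.  All the logarithms are measured by one integer J,
    about the binary length of H N. *)

Set Implicit Arguments.
Unset Strict Implicit.
Unset Printing Implicit Defensive.

Import Order.TTheory GRing.Theory Num.Theory.

Local Open Scope ring_scope.

(** * Sums over divisors of the von Mangoldt and Moebius functions *)

Section Divisors.
Variable V : nmodType.
Implicit Types f F : nat -> V.

(** Divisor sums appear in two shapes: over the list of divisors, for identities,
    and over a fixed range with a divisibility test, for exchanging sums. *)
Lemma sum_dvdn f N k : (0 < k <= N)%N ->
  \sum_(1 <= m < N.+1 | (m %| k)%N) f m = \sum_(d <- divisors k) f d.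
Proof.
case/andP=> k0 kN; rewrite -big_filter; apply/perm_big/uniq_perm.
- by rewrite filter_uniq// iota_uniq.
- exact: divisors_uniq.
move=> d; rewrite mem_filter mem_index_iota -dvdn_divisors//.
case dk: (d %| k)%N => //=; have := dvdn_leq k0 dk.
by have := dvdn_gt0 k0 dk; lia.
Qed.

Lemma sum_eq_nat F N k : (0 < k <= N)%N ->
  \sum_(1 <= d < N.+1 | d == k) F d = F k.
Proof. by move=> kN; rewrite big_nat1_eq ltnS kN. Qed.

Lemma sum_mul_eq (c : V) N m k : (0 < m)%N -> (0 < k <= N)%N ->
  \sum_(1 <= n < N.+1 | k == (m * n)%N) c = if (m %| k)%N then c else 0.
Proof.
move=> m0 /andP[k0 kN]; case: ifPn => mk.
  have kmN : (0 < k %/ m <= N)%N.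
    by rewrite divn_gt0// (dvdn_leq k0 mk)/= (leq_trans (leq_div _ _)).
  rewrite -[RHS](sum_eq_nat (fun=> c) kmN); apply: eq_bigl => n; rewrite eq_sym; apply/eqP/eqP => [<-|->].
    by rewrite mulKn.
  by rewrite mulnC divnK.
by rewrite big1// => n /eqP kE; move: mk; rewrite kE dvdn_mulr.
Qed.

End Divisors.

(** Strong induction, removing from n its least prime factor p.  The divisors of n
    that do not divide n / p and carry a nonzero weight reduce to a single one, the
    exact power of p in n, and its weight ln p is what ln n gains over ln (n / p). *)
Lemma dsum_mangoldt (R : realType) n : (0 < n)%N ->
  \sum_(d <- divisors n) mangoldt R d = ln n%:R.
Proof.
have [m] := ubnP n; elim: m => // m IH in n *.
rewrite ltnS => nm n0; have [n1|n1] := leqP n 1.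
  have -> : n = 1%N by lia.
  by rewrite /divisors/= big_seq1 ln1 /mangoldt.
have pp := pdiv_prime n1; set p := pdiv n in pp *.
have pn : (p %| n)%N := pdiv_dvd n.
pose n' := (n %/ p)%N; have nE : n = (p * n')%N by rewrite mulnC divnK.
have p0 := prime_gt0 pp; have p1 := prime_gt1 pp.
have n'0 : (0 < n')%N by move: n0; rewrite nE muln_gt0 => /andP[].
have n'n : (n' < n)%N by rewrite nE ltn_Pmull.
rewrite -(sum_dvdn _ (N := n)); last by rewrite n0 leqnn.
rewrite (bigID (fun m => m %| n')%N)/=.
have -> : \sum_(1 <= i < n.+1 | (i %| n)%N && (i %| n')%N) mangoldt R i = ln n'%:R.
  rewrite -(IH n') ?(leq_trans n'n)// -(sum_dvdn _ (N := n)); last by rewrite n'0 ltnW.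
  apply: eq_bigl => i; rewrite andbC; case iE: (i %| n')%N => //=.
  by rewrite nE dvdn_mull.
pose k := logn p n'; pose r := (p ^ k.+1)%N.
have rn : (r %| n)%N by rewrite /r nE expnS dvdn_mul// pfactor_dvdnn.
have rn' : ~~ (r %| n')%N by rewrite /r pfactor_dvdn// -/k ltnn.
have rN : (0 < r <= n)%N by rewrite expn_gt0 p0 dvdn_leq.
have -> : \sum_(1 <= i < n.+1 | (i %| n)%N && ~~ (i %| n')%N) mangoldt R i = ln p%:R.
  rewrite -[RHS](mangoldt_pow R k pp) -/r -[RHS](sum_eq_nat (mangoldt R) rN).
  rewrite big_mkcond [RHS]big_mkcond; apply: eq_bigr => i _.
  have [->|ir] := eqVneq i r; first by rewrite rn rn'.
  case: ifP => // /andP[iin iN]; apply: mangoldt_eq0 => s l sp iE.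
  have [sE|sp'] := eqVneq s p; last first.
    move: iN; rewrite -(@Gauss_dvdr i p)//; first by rewrite -nE iin.
    by rewrite iE coprimeXl// prime_coprime// dvdn_prime2.
  move: iin iN ir; rewrite iE sE !pfactor_dvdn// nE lognM//.
  rewrite (@pfactorK p 1 pp) -/k /r eqn_exp2l// => ? ?.
  by lia.
by rewrite nE natrM lnM ?posrE ?ltr0n// addrC.
Qed.

Section Mobius.
Variable R : realType.

Definition mobius (n : nat) : R :=
  if all (fun p => logn p n == 1)%N (primes n) then (-1) ^+ size (primes n) else 0.

Lemma mobius1 : mobius 1 = 1. Proof. by rewrite /mobius/= expr0. Qed.

Lemma mobius_le1 n : `|mobius n| <= 1.
Proof.
by rewrite /mobius; case: ifP => _; rewrite ?normr0 ?ler01// normrX normrN1 expr1n.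
Qed.

Lemma mobius_primeM p d : prime p -> (0 < d)%N -> ~~ (p %| d)%N ->
  mobius (p * d) = - mobius d.
Proof.
move=> pp d0 pd; have p0 := prime_gt0 pp.
have pE : perm_eq (primes (p * d)) (p :: primes d).
  apply: uniq_perm; rewrite ?primes_uniq//= ?primes_uniq ?mem_primes ?pp ?d0 ?(negbTE pd)//.
  by move=> x; rewrite primesM// primes_prime// !inE.
rewrite /mobius (perm_all _ pE) (perm_size pE)/=.
rewrite lognM// (@pfactorK p 1 pp) (lognE p d) (negbTE pd) pp d0 /=.
under eq_in_all => r.
  rewrite mem_primes => /and3P[rp _ rd]; rewrite lognM//.
  have rp' : r != p by apply: contraNneq pd => <-.
  rewrite (lognE r p) rp p0 /= dvdn_prime2// (negbTE rp') add0n; over.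
by case: ifP => _; rewrite ?oppr0// exprS mulN1r.
Qed.

Lemma mobius_sq p n : prime p -> (0 < n)%N -> (p ^ 2 %| n)%N -> mobius n = 0.
Proof.
move=> pp n0; rewrite pfactor_dvdn// => h; rewrite /mobius; case: ifP => // /allP.
have pin : p \in primes n by rewrite -logn_gt0; lia.
by move=> /(_ _ pin)/eqP h1; rewrite h1 in h.
Qed.

(** Fix a prime p dividing n > 1.  A divisor d prime to p cancels against p d, and
    the divisors p d with p still dividing d are not squarefree. *)
Lemma dsum_mobius n : (0 < n)%N -> \sum_(d <- divisors n) mobius d = (n == 1)%:R.
Proof.
move=> n0; have [->|n1] := eqVneq n 1%N.
  by rewrite /divisors/= big_seq1 mobius1.
have {n1}n1 : (1 < n)%N by lia.
have pp := pdiv_prime n1; set p := pdiv n in pp *.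
have pn : (p %| n)%N := pdiv_dvd n; have p0 := prime_gt0 pp.
rewrite -(sum_dvdn _ (N := n)); last by rewrite n0 leqnn.
rewrite (bigID (fun d => p %| d)%N)/= addrC.
have -> : \sum_(1 <= i < n.+1 | (i %| n)%N && (p %| i)%N) mobius i
  = \sum_(1 <= e < n.+1 | (p * e %| n)%N) mobius (p * e).
  transitivity (\sum_(1 <= i < n.+1 | (i %| n)%N) 
      \sum_(1 <= e < n.+1 | i == (p * e)%N) mobius i).
    rewrite big_mkcondr/= big_nat_cond [RHS]big_nat_cond.
    apply: eq_bigr => i /andP[/andP[i1 iN] _].
    by rewrite sum_mul_eq// i1 -ltnS.
  rewrite (exchange_big_dep xpredT)//= [RHS]big_mkcond/= big_nat [RHS]big_nat.
  apply: eq_bigr => e /andP[e1 en]; case: ifPn => pe.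
    rewrite -(@sum_eq_nat _ mobius n (p * e)%N); last by rewrite muln_gt0 p0 e1 dvdn_leq.
    by apply: eq_bigl => i; apply/andP/idP => [[]//|/eqP ->].
  by rewrite big1// => i /andP[iN /eqP iE]; move: pe; rewrite -iE iN.
rewrite [X in _ + X](bigID (fun e => p %| e)%N)/= [X in _ + (X + _)]big1 ?add0r.
  rewrite big_mkcond/= [X in _ + X]big_mkcond/= -big_split/= big_nat big1// => d /andP[d0 _].
  case pd: (p %| d)%N; rewrite ?andbF ?addr0// !andbT.
  rewrite Gauss_dvd ?prime_coprime ?pd// pn/=.
  by case: ifP => // _; rewrite ?addr0// mobius_primeM ?pd// subrr.
move=> e /andP[pen pe]; apply: (mobius_sq pp).
  by move: n0; case/dvdnP: pen => c ->; rewrite muln_gt0 => /andP[].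
by rewrite expnS expn1 dvdn_mul.
Qed.
End Mobius.

(** * Moments of the divisor function *)

Lemma sum_dyadic (V : nmodType) (F : nat -> V) J :
  \sum_(1 <= n < 2 ^ J) F n = \sum_(j < J) \sum_(2 ^ j <= n < 2 ^ j.+1) F n.
Proof.
elim: J => [|J IH]; first by rewrite big_ord0 big_geq.
rewrite big_ord_recr/= -IH (big_cat_nat (n := 2 ^ J)) ?expn_gt0 ?leq_exp2l//=.
Qed.

Lemma sum_shift (V : nmodType) (F : nat -> V) m l :
  \sum_(m <= k < m + l) F k = \sum_(i < l) F (i + m)%N.
Proof. by rewrite -{1}[m]add0n big_addn addKn big_mkord. Qed.

Section Moments.
Variable R : realType.
Implicit Types f t F : nat -> R.

Lemma sum_nat_ge0 F a b : (forall i, 0 <= F i) -> 0 <= \sum_(a <= i < b) F i.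
Proof. by move=> F0; apply: sumr_ge0. Qed.

Lemma single_le_sum F a b i : (forall i, 0 <= F i) -> (a <= i < b)%N ->
  F i <= \sum_(a <= j < b) F j.
Proof.
move=> F0 iab; have /= -> : F i = \sum_(a <= j < b | j == i) F j.
  by rewrite big_nat1_eq iab.
by rewrite [leRHS](bigID (pred1 i))/= lerDl sumr_ge0.
Qed.

Lemma sum_nat_widen F a b c : (forall i, 0 <= F i) -> (b <= c)%N ->
  \sum_(a <= j < b) F j <= \sum_(a <= j < c) F j.
Proof.
move=> F0 bc; have [ab|ba] := leqP a b; last by rewrite big_geq ?sumr_ge0// ltnW.
by rewrite [leRHS](big_cat_nat (n := b))//= lerDl sumr_ge0.
Qed.

Lemma sum_const_nat (c : R) a b : \sum_(a <= j < b) c = (b - a)%:R * c.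
Proof. by rewrite sumr_const_nat mulr_natl. Qed.

Lemma harmonic_pow2 J : \sum_(1 <= n < 2 ^ J) (n%:R)^-1 <= J%:R :> R.
Proof.
rewrite sum_dyadic -[leRHS]mulr1 mulr_natl -[X in _ *+ X]card_ord -sumr_const.
apply: ler_sum => j _.
have h : (0 : R) < 2 ^+ j by rewrite exprn_gt0.
apply: (@le_trans _ _ (\sum_(2 ^ j <= n < 2 ^ j.+1) (2 ^+ j)^-1)).
  rewrite big_nat [leRHS]big_nat; apply: ler_sum => n /andP[jn _].
  by rewrite lef_pV2 ?posrE// -?natrX ?ler_nat// ltr0n (leq_trans _ jn)// expn_gt0.
rewrite sum_const_nat expnS mul2n -addnn addnK natrX mulfV// lt0r_neq0//.
Qed.

Lemma harmonic_le M J : (M < 2 ^ J)%N -> \sum_(1 <= n < M.+1) (n%:R)^-1 <= J%:R :> R.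
Proof.
move=> MJ; apply: le_trans (harmonic_pow2 J).
by apply: sum_nat_widen => // i; rewrite invr_ge0.
Qed.

Lemma count_dvdn_le e K : (0 < e)%N ->
  \sum_(1 <= k < K.+1 | (e %| k)%N) 1 <= K%:R / e%:R :> R.
Proof.
move=> e0; apply: (@le_trans _ _ (\sum_(1 <= k < K.+1)
    \sum_(1 <= j < (K %/ e).+1 | k == (e * j)%N) 1)).
  rewrite big_mkcond/= big_nat [leRHS]big_nat; apply: ler_sum => k /andP[k0 kK].
  case: ifP => [/dvdnP[c kE]|_]; last by rewrite sumr_ge0.
  rewrite big_mkcond/=; apply: le_trans (@single_le_sum _ _ _ c _ _).
  - by rewrite kE mulnC eqxx.
  - by move=> i; case: ifP.
  move: k0; rewrite kE muln_gt0 => /andP[-> _]/=.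
  by rewrite ltnS leq_divRL// -kE -ltnS.
rewrite (exchange_big_dep xpredT)//=.
apply: (@le_trans _ _ (\sum_(1 <= j < (K %/ e).+1) 1)).
  apply: ler_sum => j _; rewrite big_nat1_eq; case: ifP => //.
rewrite sum_const_nat mulr1 subn1/= ler_pdivlMr ?ltr0n// -natrM ler_nat.
exact: leq_divM.
Qed.

Definition submul t := forall a b, (0 < a)%N -> (0 < b)%N -> t (a * b)%N <= t a * t b.

(** Open the square: a pair (m1, m2) of divisors of k with gcd d is (d a, d b) with
    a and b coprime, so d a b divides k, and submultiplicativity separates the three
    variables; then count the multiples of d a b up to K.  With t = 1 this is the
    mean square of the divisor function, with t = tau that of the ternary one. *)
Lemma sq_divisor_sum_le t K M : (forall i, 0 <= t i) -> submul t ->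
  \sum_(1 <= k < K.+1) (\sum_(1 <= m < M.+1 | (m %| k)%N) t m) ^+ 2 <=
  K%:R * (\sum_(1 <= d < M.+1) t d ^+ 2 / d%:R) *
    (\sum_(1 <= a < M.+1) t a / a%:R) ^+ 2.
Proof.
move=> t0 tM.
pose G d a b : R := t d ^+ 2 * (t a * t b).
have G0 d a b : 0 <= G d a b by rewrite /G !mulr_ge0.
pose T k := \sum_(1 <= d < M.+1) \sum_(1 <= a < M.+1) \sum_(1 <= b < M.+1)
   (if (d * (a * b) %| k)%N then G d a b else 0).
apply: (@le_trans _ _ (\sum_(1 <= k < K.+1) T k)).
  rewrite big_nat [leRHS]big_nat; apply: ler_sum => k /andP[k0 kK].
  rewrite expr2 big_mkcond/= big_distrlr/=.
  pose D m1 m2 d a b := (m1 == d * a)%N && (m2 == d * b)%N.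
  apply: (@le_trans _ _ (\sum_(1 <= m1 < M.+1) \sum_(1 <= m2 < M.+1)
     \sum_(1 <= d < M.+1) \sum_(1 <= a < M.+1) \sum_(1 <= b < M.+1)
     (if D m1 m2 d a b && (d * (a * b) %| k)%N then G d a b else 0))).
    rewrite big_nat [leRHS]big_nat; apply: ler_sum => m1 /andP[m10 m1M].
    rewrite big_nat [leRHS]big_nat; apply: ler_sum => m2 /andP[m20 m2M].
    have sum0 d : 0 <= \sum_(1 <= a < M.+1) \sum_(1 <= b < M.+1)
     (if D m1 m2 d a b && (d * (a * b) %| k)%N then G d a b else 0).
      by apply: sum_nat_ge0 => a; apply: sum_nat_ge0 => b; case: ifP.
    case: ifP => m1k; last by rewrite mul0r sum_nat_ge0.
    case: ifP => m2k; last by rewrite mulr0 sum_nat_ge0.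
    have d0 : (0 < gcdn m1 m2)%N by rewrite gcdn_gt0 m10.
    pose d := gcdn m1 m2; pose a := (m1 %/ d)%N; pose b := (m2 %/ d)%N.
    have m1E : m1 = (d * a)%N by rewrite mulnC divnK// dvdn_gcdl.
    have m2E : m2 = (d * b)%N by rewrite mulnC divnK// dvdn_gcdr.
    have a0 : (0 < a)%N by rewrite divn_gt0// dvdn_leq// dvdn_gcdl.
    have b0 : (0 < b)%N by rewrite divn_gt0// dvdn_leq// dvdn_gcdr.
    have inM x : (0 < x)%N -> (x %| m1)%N || (x %| m2)%N -> (1 <= x < M.+1)%N.
      by move=> -> /orP[] /dvdn_leq h; rewrite ltnS (leq_trans (h _)).
    have cab : coprime a b.
      by rewrite /coprime -(eqn_pmul2l d0) muln_gcdr -m1E -m2E muln1.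
    apply: le_trans (single_le_sum sum0 (inM d d0 _)); last by rewrite dvdn_gcdl.
    apply: le_trans (@single_le_sum _ _ _ a _ (inM a a0 _)); first last.
    - by rewrite [m1]m1E dvdn_mull.
    - by move=> i; apply: sum_nat_ge0 => j; case: ifP.
    apply: le_trans (@single_le_sum _ _ _ b _ (inM b b0 _)); first last.
    - by rewrite [m2]m2E dvdn_mull ?orbT.
    - by move=> i; case: ifP.
    have -> : D m1 m2 d a b by rewrite /D -m1E -m2E !eqxx.
    have -> : (d * (a * b) %| k)%N.
      case/dvdnP: m1k => x kE.
      have h : (b %| x * a)%N.
        by rewrite -(dvdn_pmul2l d0) mulnCA -m1E -m2E -kE.
      move: h; rewrite Gauss_dvdl 1?coprime_sym// => h.
      by rewrite mulnA -m1E kE [X in (X %| _)%N]mulnC dvdn_mul.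
    rewrite /G {1}m1E {1}m2E.
    rewrite (le_trans (ler_pM _ _ (tM _ _ d0 a0) (tM _ _ d0 b0)))//.
    by rewrite expr2 mulrACA.
  apply: (@le_trans _ _ (\sum_(1 <= d < M.+1) \sum_(1 <= a < M.+1)
     \sum_(1 <= b < M.+1) \sum_(1 <= m1 < M.+1) \sum_(1 <= m2 < M.+1)
     (if D m1 m2 d a b && (d * (a * b) %| k)%N then G d a b else 0))).
    rewrite le_eqVlt; apply/orP; left; apply/eqP.
    under eq_bigr do rewrite exchange_big/=; rewrite exchange_big/=.
    apply: eq_bigr => d _.
    under eq_bigr do rewrite exchange_big/=; rewrite exchange_big/=.
    apply: eq_bigr => a _.
    by under eq_bigr do rewrite exchange_big/=; rewrite exchange_big/=.
  apply: ler_sum => d _; apply: ler_sum => a _; apply: ler_sum => b _.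
  case: ifP => dk; last by rewrite big1// => i _; rewrite big1// => j _; rewrite andbF.
  apply: (@le_trans _ _ (\sum_(1 <= m1 < M.+1 | m1 == (d * a)%N)
     \sum_(1 <= m2 < M.+1 | m2 == (d * b)%N) G d a b)).
    rewrite [leRHS]big_mkcond/=; apply: ler_sum => m1 _; rewrite /D.
    case: eqP => _ /=; last by rewrite big1.
    by rewrite [leRHS]big_mkcond/=; apply: ler_sum => m2 _; rewrite andbT.
  by rewrite !big_nat1_eq; do 2 case: ifP => //.
rewrite /T exchange_big/= mulr_sumr mulr_suml.
apply: ler_sum_nat => d /andP[d0 _].
rewrite exchange_big/= (expr2 (\sum_(_ <= _ < _) _)) big_distrlr/= mulr_sumr.
apply: ler_sum_nat => a /andP[a0 _].
rewrite exchange_big/= mulr_sumr.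
apply: ler_sum_nat => b /andP[b0 _].
rewrite -big_mkcond/=.
have -> : \sum_(1 <= i < K.+1 | (d * (a * b) %| i)%N) G d a b =
    G d a b * \sum_(1 <= i < K.+1 | (d * (a * b) %| i)%N) 1.
  by rewrite mulr_sumr; apply: eq_bigr => *; rewrite mulr1.
apply: (@le_trans _ _ (G d a b * (K%:R / (d * (a * b))%:R))).
  by rewrite ler_wpM2l// count_dvdn_le// !muln_gt0 d0 a0.
rewrite le_eqVlt; apply/orP; left; apply/eqP; rewrite /G !natrM.
by field; rewrite !pnatr_eq0 !gt_eqF.
Qed.

Definition tau (k : nat) : R := (size (divisors k))%:R.

Lemma tau_ge0 k : 0 <= tau k. Proof. exact: ler0n. Qed.

Lemma tau_ge1 k : (0 < k)%N -> 1 <= tau k.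
Proof.
move=> k0; rewrite /tau ler1n; have := divisors_id k0.
by case: (divisors k).
Qed.

Lemma tauE N k : (0 < k <= N)%N -> tau k = \sum_(1 <= m < N.+1 | (m %| k)%N) 1.
Proof. by move=> kN; rewrite sum_dvdn// big_const_seq count_predT iter_addr_0. Qed.

(** A divisor e of a b is recovered from gcd (e, a), which divides a, and its
    cofactor, which divides b. *)
Lemma submul_tau : submul tau.
Proof.
move=> a b a0 b0; rewrite /tau -natrM ler_nat -(size_allpairs muln).
apply: (@uniq_leq_size _ _ [seq (x * y)%N | x <- divisors a, y <- divisors b]).
  exact: divisors_uniq.
move=> d; rewrite -dvdn_divisors ?muln_gt0 ?a0// => dab.
have d0 : (0 < d)%N by apply: dvdn_gt0 dab; rewrite muln_gt0 a0.
have g0 : (0 < gcdn d a)%N by rewrite gcdn_gt0 d0.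
apply/allpairsP; exists (gcdn d a, d %/ gcdn d a)%N => /=.
rewrite -!dvdn_divisors// dvdn_gcdr mulnC divnK ?dvdn_gcdl//; split=> //.
rewrite -(@Gauss_dvdr _ (a %/ gcdn d a)).
  by rewrite -(dvdn_pmul2l g0) mulnA ![(gcdn d a * _)%N]mulnC !divnK ?dvdn_gcdl ?dvdn_gcdr.
by rewrite /coprime -(eqn_pmul2l g0) muln_gcdr ![(gcdn d a * _)%N]mulnC !divnK
  ?dvdn_gcdl ?dvdn_gcdr// mul1n.
Qed.

Lemma sum_tau_sq_le K J : (K < 2 ^ J)%N ->
  \sum_(1 <= k < K.+1) tau k ^+ 2 <= K%:R * J%:R ^+ 3.
Proof.
move=> KJ; have h := harmonic_le KJ.
have h0 : 0 <= \sum_(1 <= n < K.+1) (n%:R)^-1 :> R by apply: sum_nat_ge0 => i; rewrite invr_ge0.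
have sub1 : submul (fun=> 1 : R) by move=> *; rewrite mulr1.
rewrite (eq_big_nat _ _ (F2 := fun k => (\sum_(1 <= m < K.+1 | (m %| k)%N) 1) ^+ 2)); last first.
  by move=> k kK; rewrite -tauE.
apply: (le_trans (sq_divisor_sum_le K K (fun=> ler01) sub1)).
have -> : \sum_(1 <= d < K.+1) 1 ^+ 2 / d%:R = \sum_(1 <= n < K.+1) (n%:R)^-1 :> R.
  by apply: eq_bigr => *; rewrite expr1n mul1r.
have -> : \sum_(1 <= d < K.+1) 1 / d%:R = \sum_(1 <= n < K.+1) (n%:R)^-1 :> R.
  by apply: eq_bigr => *; rewrite mul1r.
by rewrite -mulrA -exprS ler_wpM2l// lerXn2r ?nnegrE.
Qed.

Lemma sum_tau_div_le M J : (M < 2 ^ J)%N ->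
  \sum_(1 <= m < M.+1) tau m / m%:R <= J%:R ^+ 2.
Proof.
move=> MJ; have h := harmonic_le MJ.
have h0 : 0 <= \sum_(1 <= n < M.+1) (n%:R)^-1 :> R by apply: sum_nat_ge0 => i; rewrite invr_ge0.
apply: le_trans (_ : (\sum_(1 <= n < M.+1) (n%:R)^-1) ^+ 2 <= _); last first.
  by rewrite lerXn2r ?nnegrE.
rewrite expr2 big_distrlr/=.
apply: (@le_trans _ _ (\sum_(1 <= m < M.+1) \sum_(1 <= a < M.+1)
   \sum_(1 <= b < M.+1 | m == (a * b)%N) (a%:R^-1 * b%:R^-1))).
  apply: ler_sum_nat => m m0; rewrite (tauE m0) mulr_suml big_mkcond/=.
  apply: ler_sum_nat => a /andP[a0 _]; rewrite mul1r.
  rewrite (eq_bigr (fun=> m%:R^-1)); last first.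
    by move=> b /eqP ->; rewrite natrM invfM.
  by rewrite sum_mul_eq//; case: ifP.
rewrite exchange_big/=; apply: ler_sum_nat => a _.
rewrite (exchange_big_dep xpredT)//=; apply: ler_sum_nat => b _.
by rewrite big_nat1_eq; case: ifP => // _; rewrite mulr_ge0 ?invr_ge0.
Qed.

Lemma sum_tau_sq_div_le M J : (M < 2 ^ J)%N ->
  \sum_(1 <= m < M.+1) tau m ^+ 2 / m%:R <= 2 * J%:R ^+ 4.
Proof.
move=> MJ; have tau20 m : 0 <= tau m ^+ 2 / m%:R by rewrite mulr_ge0 ?sqr_ge0 ?invr_ge0.
apply: (@le_trans _ _ (\sum_(1 <= m < 2 ^ J) tau m ^+ 2 / m%:R)).
  exact: sum_nat_widen.
rewrite sum_dyadic [leRHS](_ : _ = \sum_(j < J) 2 * J%:R ^+ 3); last first.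
  by rewrite sumr_const card_ord -[RHS]mulr_natr -mulrA -exprSr.
apply: ler_sum => j _; have p0 : (0 : R) < (2 ^ j)%:R by rewrite ltr0n expn_gt0.
apply: (@le_trans _ _ (\sum_(2 ^ j <= m < 2 ^ j.+1) tau m ^+ 2 / (2 ^ j)%:R)).
  apply: ler_sum_nat => m /andP[jm _]; rewrite ler_wpM2l ?sqr_ge0//.
  by rewrite lef_pV2 ?posrE// ?ler_nat// ltr0n (leq_trans _ jm)// expn_gt0.
rewrite -mulr_suml ler_pdivrMr//.
have p1 : (0 < 2 ^ j.+1)%N by rewrite expn_gt0.
apply: (@le_trans _ _ (\sum_(1 <= m < (2 ^ j.+1).-1.+1) tau m ^+ 2)).
  rewrite prednK// [leRHS](big_cat_nat (n := 2 ^ j)) ?expn_gt0 ?leq_exp2l//=.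
  by rewrite lerDr; apply: sumr_ge0 => *; rewrite sqr_ge0.
have /sum_tau_sq_le/le_trans : ((2 ^ j.+1).-1 < 2 ^ J)%N by rewrite prednK// leq_exp2l.
apply; rewrite mulrAC ler_wpM2r ?exprn_ge0//.
by rewrite -natrM ler_nat expnS leq_pred.
Qed.

End Moments.

(** * Exponentials and geometric sums *)

Notation normc := Normc.normc.

Section ComplexNorm.
Local Open Scope complex_scope.
Variable R : realType.
Implicit Types z w : R[i].

Lemma normcE2 (x y : R) : normc (x +i* y) = Num.sqrt (x ^+ 2 + y ^+ 2).
Proof. by []. Qed.

Lemma normc_ge0 z : 0 <= normc z.
Proof. by case: z => x y; exact: sqrtr_ge0. Qed.

Lemma normc_real (x : R) : normc x%:C = `|x|.
Proof. by rewrite /normc/= expr0n/= addr0 sqrtr_sqr. Qed.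

Lemma normc_sum I (r : seq I) (P : pred I) (F : I -> R[i]) :
  normc (\sum_(i <- r | P i) F i) <= \sum_(i <- r | P i) normc (F i).
Proof.
elim/big_rec2: _ => [|i y z _ h]; first by rewrite Normc.normc0.
by rewrite (le_trans (le_normcD _ _))// lerD2l.
Qed.

Lemma normcJ z : normc (conjc z) = normc z.
Proof. by case: z => x y; rewrite /normc/= sqrrN. Qed.

Lemma normc_sqr z : ((normc z) ^+ 2)%:C = z * conjc z.
Proof.
case: z => x y; rewrite normcE2 sqr_sqrtr ?addr_ge0 ?sqr_ge0//.
by apply/eqP; rewrite eq_complex/=; apply/andP; split; apply/eqP; ring.
Qed.

End ComplexNorm.

Section Exponential.
Import numFieldNormedType.Exports.
Local Open Scope complex_scope.
Variable R : realType.
Implicit Types x y D d : R.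

Lemma eD x y : e (x + y) = e x * e y.
Proof.
rewrite /e mulrDr cosD sinD; apply/eqP; rewrite eq_complex/=.
by rewrite eqxx/= addrC.
Qed.

Lemma e0 : e (0 : R) = 1.
Proof. by rewrite /e mulr0 cos0 sin0. Qed.

Lemma eN x : e (- x) = conjc (e x).
Proof. by rewrite /e mulrN cosN sinN. Qed.

Lemma normc_e x : normc (e x) = 1.
Proof. by rewrite /e normcE2 cos2Dsin2 sqrtr1. Qed.

Lemma e1 : e (1 : R) = 1.
Proof. by rewrite /e mulr1 mulr_natl cos2pi sin2pi. Qed.

Lemma e_nat n : e (n%:R : R) = 1.
Proof. by elim: n => [|n IH]; rewrite ?e0// -natr1 eD IH e1 mulr1. Qed.

Lemma e_int (z : int) : e (z%:~R : R) = 1.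
Proof.
case: z => n; first exact: e_nat.
by rewrite NegzE mulrNz eN -pmulrn e_nat rmorph1.
Qed.

(** Comparable to the distance from x to the nearest integer; it is the factor that
    makes a geometric sum of ratio e x telescope. *)
Definition delta x := normc (1 - e x).

Lemma delta_ge0 x : 0 <= delta x. Proof. exact: normc_ge0. Qed.

Lemma deltaN x : delta (- x) = delta x.
Proof.
by rewrite /delta eN -(normcJ (1 - e x)) rmorphB rmorph1.
Qed.

Lemma deltaDz x (z : int) : delta (x + z%:~R) = delta x.
Proof. by rewrite /delta eD e_int mulr1. Qed.

(** A crude form of Jordan's inequality, enough for bounds up to constants. *)
Lemma sin_ge_half x : 0 <= x <= pi / 2 -> x / 2 <= sin x.
Proof.
move=> /andP[x0 xpi]; pose z := x / 2.
have [z0|z0] := eqVneq z 0.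
  by rewrite -/z z0 (_ : x = 0) ?sin0//; move: z0; rewrite /z; lra.
have {}z0 : 0 < z by rewrite lt_neqAle eq_sym z0/= divr_ge0.
have pi2 := @pi_ge2 R.
have zpi : z < pi / 2 by rewrite /z; lra.
(* sin z >= z cos z by the mean value theorem; doubling z loses a factor cos ^ 2 z >= 1 / 2 *)
have cosz : 0 <= cos z by apply: cos_ge0_pihalf; lra.
have sz : z * cos z <= sin z.
  have dsin y : y \in `]0, z[ -> is_derive y 1 sin (cos y :> R).
    by move=> _; exact: is_derive_sin.
  have [|c] := MVT z0 dsin.
    by apply: continuous_subspaceT => y; exact: continuous_sin.
  rewrite in_itv/= sin0 !subr0 => /andP[c0 cz] ->.
  by rewrite mulrC ler_wpM2r// ?(ltW z0)// ltW// ltr_cos ?in_itv/=; lra.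
have -> : x = z *+ 2 by rewrite /z; lra.
rewrite sin_mulr2n.
have : z * cos z * cos z <= cos z * sin z by rewrite mulrC ler_wpM2l.
have c2 : cos x = cos z ^+ 2 *+ 2 - 1 by rewrite -cos_mulr2n; congr cos; rewrite /z; lra.
have cx : 0 <= cos x by apply: cos_ge0_pihalf; lra.
nra.
Qed.

Lemma delta_half x : 0 <= x <= 1 / 2 -> 2 * x <= delta x.
Proof.
move=> /andP[x0 x2]; have pi2 := @pi_ge2 R.
have s := @sin_ge_half (pi * x) _.
have hs : 0 <= pi * x <= pi / 2 by apply/andP; split; nra.
have {s} s := s hs.
have -> : delta x = 2 * sin (pi * x).
  have s0 : 0 <= sin (pi * x) by nra.
  rewrite /delta /e/= -[RHS]ger0_norm; last by rewrite mulr_ge0.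
  rewrite -[RHS]sqrtr_sqr; congr Num.sqrt.
  have -> : 2 * pi * x = (pi * x) *+ 2 by rewrite mulr2n; ring.
  rewrite cos_mulr2n sin_mulr2n.
  have := cos2Dsin2 (pi * x); set c := cos _; set t := sin _ => h.
  have -> : (0 - (c * t) *+ 2) ^+ 2 = 4 * c ^+ 2 * t ^+ 2 by ring.
  have tE : t ^+ 2 = 1 - c ^+ 2 by rewrite -h; ring.
  have -> : (2 * t) ^+ 2 = 4 * t ^+ 2 by ring.
  by rewrite tE; ring.
nra.
Qed.

Lemma delta_half1 x : 1 / 2 <= x <= 1 -> 2 * (1 - x) <= delta x.
Proof.
move=> h; have -> : delta x = delta (1 - x).
  by rewrite -deltaN -(deltaDz _ 1) addrC.
by apply: delta_half; lra.
Qed.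

(** Comparable to min (D, 1 / d), but meaningful at d = 0, which does occur, in the
    diagonal terms of bilinear sums. *)
Definition kappa (D d : R) := D / (1 + D * d).

Lemma kappa_ge0 D d : 0 <= D -> 0 <= d -> 0 <= kappa D d.
Proof. by move=> D0 d0; rewrite divr_ge0// addr_ge0// mulr_ge0. Qed.

Lemma kappa_le (D D' d d' : R) : 0 <= D -> D <= D' -> 0 <= d' -> d' <= d ->
  kappa D d <= kappa D' d'.
Proof.
move=> D0 DD d'0 dd.
have p1 : 0 < 1 + D * d by nra.
have p2 : 0 < 1 + D' * d' by nra.
have DD0 : 0 <= D * D' by apply: mulr_ge0; lra.
have h : D * D' * d' <= D * D' * d by rewrite ler_wpM2l.
by rewrite /kappa ler_pdivrMr// [leRHS]mulrAC ler_pdivlMr//; lra.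
Qed.

Lemma kappa_leD D d : 0 <= D -> 0 <= d -> kappa D d <= D.
Proof.
move=> D0 d0; have p := mulr_ge0 D0 d0.
by rewrite /kappa ler_pdivrMr ?mulrDr; [rewrite mulr1 lerDl mulr_ge0|lra].
Qed.

Lemma kappa_leV D d : 0 <= D -> 0 < d -> kappa D d <= d^-1.
Proof.
move=> D0 d0; have p := mulr_ge0 D0 (ltW d0).
by rewrite /kappa ler_pdivrMr 1?mulrC ?ler_pdivlMr; lra.
Qed.

Lemma le_kappa (S D d v : R) : 1 <= v -> 0 <= S -> 0 <= d -> S <= D -> S * d <= 2 * v ->
  S <= 4 * v * kappa D d.
Proof.
move=> v1 S0 d0 SD Sd; have D0 : 0 <= D by lra.
have p1 : 0 < 1 + D * d by nra.
rewrite /kappa mulrA ler_pdivlMr//.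
have : D * (S * d) <= D * (2 * v) by rewrite ler_wpM2l.
by nra.
Qed.

(** Multiplying the sum by e (v th) shifts it by the period v of Q, so
    1 - e (v th) times the sum is a difference of two sums of length v.  The
    denominator is governed by v th: this is how the hypothesis on alpha v serves a sum
    twisted by alpha. *)
Lemma periodic_exp_sum (v : nat) (Q : pred nat) (th X : R) A B :
  (0 < v)%N -> (forall n, Q (n + v)%N = Q n) -> 0 <= X -> (B - A)%:R <= X ->
  normc (\sum_(A <= n < B | Q n) e (th * n%:R)) <=
    4 * v%:R * kappa X (delta (v%:R * th)).
Proof.
move=> v0 Qv X0 BAX; pose F n : R[i] := if Q n then e (th * n%:R) else 0.
have F1 n : normc (F n) <= 1.
  by rewrite /F; case: ifP; rewrite ?normc_e// Normc.normc0.
have SF a b : normc (\sum_(a <= n < b) F n) <= (b - a)%:R.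
  apply: le_trans (normc_sum _ _ _) _; rewrite -[leRHS]mulr1 -sum_const_nat.
  by apply: ler_sum.
have -> : \sum_(A <= n < B | Q n) e (th * n%:R) = \sum_(A <= n < B) F n.
  by rewrite big_mkcond.
apply: le_kappa; rewrite ?ler1n ?normc_ge0 ?delta_ge0//.
  exact: le_trans BAX.
rewrite -Normc.normcM mulrBr mulr1 mulr_suml.
have FE n : F n * e (v%:R * th) = F (n + v)%N.
  rewrite /F Qv; case: ifP; last by rewrite mul0r.
  by move=> _; rewrite -eD natrD; congr e; ring.
have -> : \sum_(A <= n < B) F n * e (v%:R * th) = \sum_(A + v <= n < B + v) F n.
  by rewrite big_addn addnK; apply: eq_bigr => n _; rewrite FE.
have h (f : nat -> R[i]) a b c : (a <= b)%N -> (b <= c)%N ->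
   \sum_(a <= n < c) f n = \sum_(a <= n < b) f n + \sum_(b <= n < c) f n.
  by move=> ab bc; rewrite (big_cat_nat (n := b)).
have [BA|AB] := ltnP B A.
  rewrite !big_geq ?subr0 ?Normc.normc0 ?mulr_ge0//; lia.
have e1 : \sum_(A <= n < B) F n + \sum_(B <= n < B + v) F n
   = \sum_(A <= n < A + v) F n + \sum_(A + v <= n < B + v) F n.
  by rewrite -!h//; lia.
rewrite (_ : _ - _ = \sum_(A <= n < A + v) F n - \sum_(B <= n < B + v) F n); last first.
  by apply/eqP; rewrite subr_eq addrAC eq_sym subr_eq e1.
apply: le_trans (le_normcD _ _) _; rewrite normcN.
have := SF A (A + v)%N; have := SF B (B + v)%N; rewrite !addKn; lra.
Qed.

End Exponential.

(** * Multiples of a number close to a / q *)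

Section Spacing.
Variables (R : realType) (b : R) (a : int) (q : nat).
Hypotheses (aq : coprimez a q) (q2 : (2 <= q)%N)
  (baq : `|b - a%:~R / q%:R| <= 1 / q%:R ^+ 2).

Let q0 : 0 < q%:R :> R. Proof. by rewrite ltr0n; lia. Qed.

(** q does not divide a l, so a l / q is at distance at least 1 / q from the integers,
    and b l differs from it by at most l / q ^ 2 <= 1 / (2 q). *)
Lemma multiple_far_from_int (l : nat) (z : int) : (0 < l <= q./2)%N ->
  1 / (2 * q%:R) <= `|b * l%:R - z%:~R|.
Proof.
move=> /andP[l0 lq].
have lq2 : (2 * l <= q)%N by have := odd_double_half q; lia.
have nz : (a * l%:Z - z * q%:Z != 0)%R.
  apply/eqP => h; have : (q %| a * l%:Z)%Z.
    by apply/dvdzP; exists z; lia.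
  rewrite Gauss_dvdzr 1?coprimez_sym// => ql.
  by have := dvdn_leq l0 ql; lia.
have n1 : 1 <= `|(a * l%:Z - z * q%:Z)%:~R| :> R.
  by rewrite -intr_norm ler1z; lia.
have E : b * l%:R - z%:~R = (a * l%:Z - z * q%:Z)%:~R / q%:R + (b - a%:~R / q%:R) * l%:R.
  by rewrite rmorphB/= !rmorphM/= -!pmulrn; field; rewrite lt0r_neq0.
have E1 : `|(b - a%:~R / q%:R) * l%:R| <= 1 / (2 * q%:R).
  rewrite normrM [`|l%:R|]ger0_norm//.
  apply: (le_trans (ler_wpM2r (ler0n _ _) baq)).
  have -> : 1 / q%:R ^+ 2 * l%:R = (2 * l)%:R / q%:R * (1 / (2 * q%:R)) :> R.
    by rewrite natrM; field; rewrite lt0r_neq0.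
  rewrite ler_piMl// ?divr_ge0//.
  by rewrite ler_pdivrMr// mul1r ler_nat.
have E2 : 1 / q%:R <= `|(a * l%:Z - z * q%:Z)%:~R / q%:R| :> R.
  by rewrite normrM normfV [`|q%:R|]ger0_norm// ler_pM2r ?invr_gt0.
rewrite E; set X := (_%:~R / _) in E2 *; set Y := (_ * l%:R) in E1 *.
have := lerB_normD X Y; have : 1 / q%:R = 2 * (1 / (2 * q%:R)) :> R.
  by field; rewrite lt0r_neq0.
lra.
Qed.

Definition fpart (x : R) := x - (Num.floor x)%:~R.

Lemma fpart_itv x : 0 <= fpart x < 1.
Proof.
have /andP[h1 h2] := floor_itv x; rewrite /fpart.
by move: h2; rewrite rmorphD/= => h2; apply/andP; split; lra.
Qed.

(** The index of the arc of length 1 / (2 q) that contains x modulo 1. *)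
Definition cell (x : R) : nat := Num.truncn (2 * q%:R * fpart x).

Lemma cell_itv x : (cell x)%:R <= 2 * q%:R * fpart x < (cell x).+1%:R.
Proof.
apply: truncn_itv; have /andP[h _] := fpart_itv x.
by rewrite !mulr_ge0.
Qed.

Lemma cell_lt x : (cell x < 2 * q)%N.
Proof.
have /andP[h1 h2] := fpart_itv x; have /andP[h _] := cell_itv x.
rewrite -(ltr_nat R) natrM (le_lt_trans h)//.
by rewrite -[ltRHS]mulr1 ltr_pM2l// mulr_gt0.
Qed.

(** The two terms measure the distance of the arc to 0 from the right and from the
    left; adding them avoids a case distinction in the sums below. *)
Lemma kappa_cell (D x : R) : 0 <= D ->
  kappa D (delta x) <=
    kappa D ((cell x)%:R / q%:R) + kappa D ((2 * q - (cell x).+1)%:R / q%:R).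
Proof.
move=> D0; have /andP[f0 f1] := fpart_itv x; have /andP[c0 c1] := cell_itv x.
have cq := cell_lt x.
have -> : delta x = delta (fpart x).
  by rewrite /fpart -mulrNz deltaDz.
have k1 : 0 <= kappa D ((cell x)%:R / q%:R) by rewrite kappa_ge0// ?divr_ge0.
have k2 : 0 <= kappa D ((2 * q - (cell x).+1)%:R / q%:R) by rewrite kappa_ge0// ?divr_ge0.
have [fh|fh] := leP (fpart x) (1 / 2).
  have := @delta_half _ (fpart x); rewrite f0 fh => /(_ isT) d.
  apply: (@le_trans _ _ (kappa D ((cell x)%:R / q%:R))); last by rewrite lerDl.
  apply: kappa_le => //.
  by apply: le_trans d; rewrite ler_pdivrMr//; lra.
have := @delta_half1 _ (fpart x); rewrite (ltW fh) (ltW f1) => /(_ isT) d.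
apply: (@le_trans _ _ (kappa D ((2 * q - (cell x).+1)%:R / q%:R))); last by rewrite lerDr.
apply: kappa_le => //.
apply: le_trans d; rewrite ler_pdivrMr// natrB// natrM; lra.
Qed.

(** Two points of one arc would differ, modulo 1, by less than 1 / (2 q). *)
Lemma cell_inj (g : R) i j : (i < q./2)%N -> (j < q./2)%N ->
  cell (g + b * i%:R) = cell (g + b * j%:R) -> i = j.
Proof.
wlog ij : i j / (i < j)%N.
  move=> H iq jq c; have [|ij|//] := ltngtP i j; first by move=> ?; exact: H.
  by apply/esym/H.
move=> iq jq cij; exfalso.
have /andP[u1 u2] := cell_itv (g + b * i%:R).
have /andP[v1 v2] := cell_itv (g + b * j%:R).
move: u1 u2 v1 v2; rewrite cij -natr1; set c := (cell _)%:R => u1 u2 v1 v2.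
have l0 : (0 < j - i <= q./2)%N by lia.
have := multiple_far_from_int
   (Num.floor (g + b * j%:R) - Num.floor (g + b * i%:R)) l0.
rewrite natrB 1?ltnW// rmorphB/=.
have -> : b * (j%:R - i%:R) - ((Num.floor (g + b * j%:R))%:~R - (Num.floor (g + b * i%:R))%:~R)
  = fpart (g + b * j%:R) - fpart (g + b * i%:R) by rewrite /fpart; ring.
set Y := fpart (_ + _ * i%:R) in u1 u2 v1 v2 *; set X := fpart _ in u1 u2 v1 v2 *.
rewrite ler_pdivrMr ?mulr_gt0// => h.
have : `|X - Y| * (2 * q%:R) < 1.
  rewrite -[X in _ * X]ger0_norm ?mulr_ge0// -normrM ltr_norml.
  by apply/andP; split; lra.
lra.
Qed.

Lemma sum_kappa_cells (D : R) L : 0 <= D -> (2 * q <= 2 ^ L)%N ->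
  \sum_(t < 2 * q) kappa D (t%:R / q%:R) <= D + q%:R * L%:R.
Proof.
move=> D0 qL; rewrite -(big_mkord xpredT (fun t => kappa D (t%:R / q%:R))).
rewrite big_ltn; last by lia.
apply: lerD; first by rewrite kappa_leD// divr_ge0.
apply: (@le_trans _ _ (\sum_(1 <= t < 2 * q) q%:R * t%:R^-1)).
  apply: ler_sum_nat => t /andP[t0 _].
  apply: le_trans (kappa_leV _ _) _ => //; first by rewrite divr_gt0// ltr0n.
  by rewrite invf_div.
rewrite -mulr_sumr ler_wpM2l// (le_trans _ (harmonic_pow2 _ L))//.
by apply: sum_nat_widen => // i; rewrite invr_ge0.
Qed.

(** The points of a block of q / 2 consecutive multiples of b lie in distinct arcs, so
    the sum over the block is at most the sum over all 2 q arcs, a harmonic sum apart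
    from the arcs next to 0. *)
Lemma sum_kappa_block (D g : R) L : 0 <= D -> (2 * q <= 2 ^ L)%N ->
  \sum_(i < q./2) kappa D (delta (g + b * i%:R)) <= 2 * (D + q%:R * L%:R).
Proof.
move=> D0 qL.
pose h (i : 'I_(q./2)) : 'I_(2 * q) := Ordinal (cell_lt (g + b * i%:R)).
have hinj : injective h.
  by move=> i j [] /cell_inj hij; apply: val_inj; exact: hij.
pose G (t : 'I_(2 * q)) : R :=
  kappa D (t%:R / q%:R) + kappa D ((2 * q - t.+1)%:R / q%:R).
have G0 t : 0 <= G t by rewrite addr_ge0// kappa_ge0// ?divr_ge0.
apply: (@le_trans _ _ (\sum_(i < q./2) G (h i))).
  by apply: ler_sum => i _; exact: kappa_cell.
apply: (@le_trans _ _ (\sum_t G t)).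
  have <- : \sum_(t in h @: [set: 'I_(q./2)]%SET) G t = \sum_(i < q./2) G (h i).
    rewrite big_imset/=; first by apply: eq_bigl => i; rewrite inE.
    by move=> i j _ _; exact: hinj.
  rewrite [leRHS](bigID (mem (h @: [set: 'I_(q./2)]%SET)))/= lerDl.
  by apply: sumr_ge0 => t _.
rewrite big_split/= mulr2n mulrDl mul1r.
have h1 := sum_kappa_cells D0 qL.
apply: lerD => //; apply: le_trans h1.
rewrite (reindex_inj rev_ord_inj)/= le_eqVlt; apply/orP; left; apply/eqP.
apply: eq_bigr => t _; congr (kappa _ (_%:R / _)).
by have := ltn_ord t; lia.
Qed.

(** Cut the range into blocks of q / 2 terms; the number of blocks is at most
    3 K / q + 1 because q <= 3 (q / 2) for q >= 2. *)
Lemma sum_kappa_le (D g : R) K L : 0 <= D -> (2 * q <= 2 ^ L)%N -> (0 < L)%N ->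
  \sum_(k < K) kappa D (delta (g + b * k%:R)) <=
    6 * L%:R * (K%:R * D / q%:R + K%:R + D + q%:R).
Proof.
move=> D0 qL L0; have l0 : (0 < q./2)%N by lia.
pose F k : R := kappa D (delta (g + b * k%:R)).
have F0 k : 0 <= F k by rewrite kappa_ge0// delta_ge0.
have blocks B : \sum_(0 <= k < B * q./2) F k <= B%:R * (2 * (D + q%:R * L%:R)).
  elim: B => [|B IH]; first by rewrite mul0n big_geq// mul0r.
  rewrite mulSn addnC (big_cat_nat (n := (B * q./2)%N)) ?leq_addr//=.
  rewrite -natr1 mulrDl mul1r; apply: lerD => //.
  have -> : \sum_(B * q./2 <= k < B * q./2 + q./2) F k = \sum_(i < q./2) F (i + B * q./2)%N.
    exact: sum_shift.
  apply: le_trans (sum_kappa_block (g + b * (B * q./2)%:R) D0 qL).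
  apply: ler_sum => i _; rewrite /F le_eqVlt; apply/orP; left; apply/eqP.
  by congr (kappa _ (delta _)); rewrite natrD; ring.
rewrite -(big_mkord xpredT F).
have KB : (K <= (K %/ q./2).+1 * q./2)%N by rewrite ltnW// ltn_ceil.
apply: (le_trans (sum_nat_widen 0 F0 KB)); apply: (le_trans (blocks _)).
have q3 : (q <= 3 * q./2)%N by lia.
have h1 : (K %/ q./2)%:R * q%:R <= 3 * K%:R :> R.
  rewrite -!natrM ler_nat; apply: leq_trans (leq_mul (leqnn _) q3) _.
  by rewrite mulnCA leq_mul// leq_divM.
have {}h1 : (K %/ q./2)%:R <= 3 * K%:R / q%:R :> R by rewrite ler_pdivlMr.
rewrite -natr1.
have L1 : 1 <= L%:R :> R by rewrite ler1n.
apply: (@le_trans _ _ ((3 * K%:R / q%:R + 1) * (2 * (L%:R * (D + q%:R))))).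
  apply: ler_pM => //; rewrite ?lerD2r//.
    by rewrite mulr_ge0// addr_ge0// mulr_ge0// ltW.
  have h2 : D + q%:R * L%:R <= L%:R * (D + q%:R).
    by rewrite mulrDr [q%:R * _]mulrC lerD2r; apply: ler_peMl.
  by apply: ler_wpM2l.
have -> : (3 * K%:R / q%:R + 1) * (2 * (L%:R * (D + q%:R)))
  = L%:R * (6 * (K%:R * D / q%:R + K%:R) + 2 * (D + q%:R)) :> R.
  by field; rewrite lt0r_neq0.
rewrite [leRHS](_ : _ = L%:R * (6 * (K%:R * D / q%:R + K%:R + D + q%:R))); last by ring.
apply: ler_wpM2l => //.
by have := ltW q0; lra.
Qed.

Lemma delta_multiple_ge k : (0 < k <= q./2)%N -> 1 <= q%:R * delta (b * k%:R).
Proof.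
move=> kq; have /andP[f0 f1] := fpart_itv (b * k%:R).
have h1 := multiple_far_from_int (Num.floor (b * k%:R)) kq.
have h2 := multiple_far_from_int (Num.floor (b * k%:R) + 1) kq.
have dE : delta (b * k%:R) = delta (fpart (b * k%:R)) by rewrite /fpart -mulrNz deltaDz.
have {}h1 : 1 / q%:R <= 2 * fpart (b * k%:R).
  move: h1; rewrite -/(fpart _) ger0_norm// => h1.
  have -> : 1 / q%:R = 2 * (1 / (2 * q%:R)) :> R by field; rewrite lt0r_neq0.
  lra.
have {}h2 : 1 / q%:R <= 2 * (1 - fpart (b * k%:R)).
  move: h2; rewrite rmorphD/= opprD addrA -/(fpart _) ler0_norm; last by lra.
  have -> : 1 / q%:R = 2 * (1 / (2 * q%:R)) :> R by field; rewrite lt0r_neq0.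
  lra.
rewrite -ler_pdivrMl// mulrC dE.
have [fh|fh] := leP (fpart (b * k%:R)) (1 / 2).
  by apply: le_trans h1 _; apply: delta_half; rewrite f0.
by apply: le_trans h2 _; apply: delta_half1; rewrite !ltW.
Qed.

(** With the cutoff X / k a whole block next to 0 would cost X; but there the multiples
    of b stay away from the integers, so the cutoff can be lowered to q.  On the later
    blocks X / k is at most X / (i q / 2) on the i-th one, and summing over i is
    harmonic. *)
Lemma sum_kappa_hyperbola (X : R) K J : 0 <= X -> (K < 2 ^ J)%N -> (2 * q <= 2 ^ J)%N ->
  (0 < J)%N ->
  \sum_(1 <= k < K.+1) kappa (X / k%:R) (delta (b * k%:R)) <=
    8 * J%:R * (X / q%:R + K%:R + q%:R).
Proof.
move=> X0 KJ qJ J0; set l := q./2; have l0 : (0 < l)%N by rewrite /l; lia.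
have l0R : 0 < l%:R :> R by rewrite ltr0n.
pose F k : R := kappa (X / k%:R) (delta (b * k%:R)).
have F0 k : 0 <= F k by rewrite kappa_ge0 ?delta_ge0// divr_ge0.
have J1 : 1 <= J%:R :> R by rewrite ler1n.
have first : \sum_(1 <= k < l) F k <= 4 * (q%:R + q%:R * J%:R).
  apply: (@le_trans _ _ (\sum_(1 <= k < l) 2 * kappa q%:R (delta (0 + b * k%:R)))).
    apply: ler_sum_nat => k /andP[k0 kl]; rewrite add0r.
    have d1 : 1 <= q%:R * delta (b * k%:R) by apply: delta_multiple_ge; rewrite k0 ltnW.
    have d0 : 0 < delta (b * k%:R) by rewrite -(pmulr_rgt0 _ q0); lra.
    apply: (le_trans (kappa_leV _ d0)); first by rewrite divr_ge0.
    rewrite /kappa mulrA ler_pdivlMr; last by lra.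
    by rewrite ler_pdivrMl//; lra.
  rewrite -mulr_sumr.
  have : \sum_(0 <= k < l) kappa q%:R (delta (0 + b * k%:R)) <= 2 * (q%:R + q%:R * J%:R).
    by rewrite big_mkord; exact: sum_kappa_block _ _ _ (ltW q0) qJ.
  rewrite big_ltn//.
  have : 0 <= kappa q%:R (delta (0 + b * 0%:R)) by rewrite kappa_ge0 ?delta_ge0// ltW.
  lra.
have blocks B : \sum_(1 <= k < B.+1 * l) F k <=
    4 * (q%:R + q%:R * J%:R) + \sum_(1 <= i < B.+1) (2 * X / l%:R * i%:R^-1 + 2 * (q%:R * J%:R)).
  elim: B => [|B IH]; first by rewrite mul1n [X in _ + X]big_geq// addr0.
  rewrite [X in _ + X]big_nat_recr//= addrA mulSn addnC.
  rewrite (big_cat_nat (n := (B.+1 * l)%N))/= ?leq_addr ?muln_gt0//.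
  apply: lerD => //; rewrite sum_shift.
  have Bl : 0 < (B.+1 * l)%:R :> R by rewrite ltr0n muln_gt0.
  have XB : 0 <= X / (B.+1 * l)%:R by rewrite divr_ge0.
  apply: (@le_trans _ _ (2 * (X / (B.+1 * l)%:R + q%:R * J%:R))); last first.
    rewrite le_eqVlt; apply/orP; left; apply/eqP; rewrite natrM.
    by field; rewrite !lt0r_neq0// ltr0n.
  apply: le_trans (sum_kappa_block (b * (B.+1 * l)%:R) XB qJ).
  apply: ler_sum => i _; rewrite /F.
  have -> : b * (i + B.+1 * l)%:R = b * (B.+1 * l)%:R + b * i%:R by rewrite natrD; ring.
  apply: kappa_le; rewrite ?delta_ge0 ?divr_ge0//.
  by rewrite ler_wpM2l// lef_pV2 ?posrE// ?ltr0n ?addn_gt0 ?muln_gt0 ?l0 ?orbT// ler_nat leq_addl.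
have KB : (K < (K %/ l).+1 * l)%N by exact: ltn_ceil.
apply: (le_trans (sum_nat_widen 1 F0 KB)); apply: (le_trans (blocks _)).
rewrite big_split/= sum_const_nat subn1/= -mulr_sumr.
have q3 : q%:R <= 3 * l%:R :> R by rewrite -natrM ler_nat /l; lia.
have h1 : (K %/ l)%:R * q%:R <= 3 * K%:R :> R.
  apply: (@le_trans _ _ ((K %/ l)%:R * (3 * l%:R))); first by rewrite ler_wpM2l.
  by rewrite mulrCA ler_wpM2l// -natrM ler_nat leq_divM.
have h2 : 2 * X / l%:R * (\sum_(1 <= i < (K %/ l).+1) i%:R^-1) <= 6 * (X / q%:R) * J%:R.
  apply: ler_pM; rewrite ?divr_ge0 ?mulr_ge0 ?sumr_ge0//.
    rewrite ler_pdivrMr// -mulrA mulrAC mulrA ler_pdivlMr//.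
    by have := ler_wpM2l X0 q3; lra.
  by apply: harmonic_le; apply: leq_ltn_trans KJ; exact: leq_div.
have h3 : (K %/ l)%:R * (2 * (q%:R * J%:R)) <= 6 * K%:R * J%:R :> R.
  have : (K %/ l)%:R * q%:R * J%:R <= 3 * K%:R * J%:R :> R by rewrite ler_wpM2r.
  by lra.
have h4 : q%:R <= q%:R * J%:R :> R by rewrite ler_peMr// ltW.
have h5 : 0 <= X / q%:R * J%:R by rewrite mulr_ge0// divr_ge0.
have h6 : 0 <= K%:R * J%:R :> R by rewrite mulr_ge0.
rewrite [leRHS](_ : _ = 8 * (X / q%:R * J%:R) + 8 * (K%:R * J%:R) + 8 * (q%:R * J%:R)); last by ring.
lra.
Qed.

End Spacing.

(** * Cauchy-Schwarz and correlations of phases *)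

Section Inequalities.
Local Open Scope complex_scope.
Variable R : realType.

(** Lagrange's identity: the defect is a sum of squares over pairs. *)
Lemma sum_CS I (r : seq I) (x y : I -> R) :
  (\sum_(i <- r) x i * y i) ^+ 2 <= (\sum_(i <- r) x i ^+ 2) * (\sum_(i <- r) y i ^+ 2).
Proof.
set A := \sum_(i <- r) x i ^+ 2; set B := \sum_(i <- r) y i ^+ 2; set C := \sum_(i <- r) _.
have : 0 <= \sum_(i <- r) \sum_(j <- r) (x i * y j - x j * y i) ^+ 2.
  by apply: sumr_ge0 => i _; apply: sumr_ge0 => j _; exact: sqr_ge0.
suff -> : \sum_(i <- r) \sum_(j <- r) (x i * y j - x j * y i) ^+ 2 = 2 * (A * B - C ^+ 2) by lra.
transitivity (\sum_(i <- r) (x i ^+ 2 * B + (y i ^+ 2 * A + (x i * y i) * (- 2 * C)))).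
  apply: eq_bigr => i _; rewrite /A /B /C !mulr_sumr -!big_split/=.
  by apply: eq_bigr => j _; ring.
by rewrite !big_split/= -!mulr_suml -/A -/B -/C; ring.
Qed.

(** Grouping the pairs (h, m) by their product trades the double sum for one long
    range of integers, at the price of a divisor-type weight. *)
Lemma collect_products (a f : nat -> R) H M : (forall m, 0 <= a m) -> (forall k, 0 <= f k) ->
  \sum_(1 <= h < H.+1) \sum_(1 <= m < M.+1) a m * f (h * m)%N <=
  \sum_(1 <= k < (H * M).+1) (\sum_(1 <= m < M.+1 | (m %| k)%N) a m) * f k.
Proof.
move=> a0 f0.
apply: (@le_trans _ _ (\sum_(1 <= h < H.+1) \sum_(1 <= m < M.+1)
   \sum_(1 <= k < (H * M).+1 | k == (m * h)%N) a m * f k)).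
  apply: ler_sum_nat => h /andP[h0 hH]; apply: ler_sum_nat => m /andP[m0 mM].
  by rewrite sum_eq_nat ?[(m * h)%N]mulnC// muln_gt0 h0 m0 leq_mul.
rewrite exchange_big/=; under eq_bigr do rewrite (exchange_big_dep xpredT)//=.
rewrite exchange_big/=; apply: ler_sum_nat => k /andP[k0 kK].
rewrite [in leRHS]big_mkcond/= mulr_suml; apply: ler_sum_nat => m /andP[m0 mM].
apply: (@le_trans _ _ (\sum_(1 <= h < (maxn H k).+1 | k == (m * h)%N) a m * f k)).
  rewrite big_mkcond [leRHS]big_mkcond; apply: sum_nat_widen.
    by move=> i; case: ifP => // _; rewrite mulr_ge0.
  by rewrite ltnS leq_maxl.
by rewrite sum_mul_eq// ?k0 ?leq_maxr//; case: ifP; rewrite ?mul0r.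
Qed.

(** Schur's test for a symmetric kernel, from 2 c c' <= c ^ 2 + c' ^ 2. *)
Lemma sum_symmetric_le (c : nat -> R) (W : nat -> nat -> R) K X :
  (forall k k', 0 <= W k k') -> (forall k k', W k k' = W k' k) ->
  (forall k, (1 <= k <= K)%N -> \sum_(1 <= k' < K.+1) W k k' <= X) ->
  \sum_(1 <= k < K.+1) \sum_(1 <= k' < K.+1) c k * c k' * W k k' <=
  (\sum_(1 <= k < K.+1) c k ^+ 2) * X.
Proof.
move=> W0 WC WX.
pose S := \sum_(1 <= k < K.+1) \sum_(1 <= k' < K.+1) c k ^+ 2 * W k k'.
have SX : S <= (\sum_(1 <= k < K.+1) c k ^+ 2) * X.
  rewrite mulr_suml; apply: ler_sum_nat => k kK.
  by rewrite -mulr_sumr ler_wpM2l ?sqr_ge0// WX.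
apply: le_trans SX.
have -> : S = 2^-1 * (S + \sum_(1 <= k < K.+1) \sum_(1 <= k' < K.+1) c k' ^+ 2 * W k k').
  have -> : \sum_(1 <= k < K.+1) \sum_(1 <= k' < K.+1) c k' ^+ 2 * W k k' = S.
    rewrite exchange_big/=; apply: eq_bigr => k _; apply: eq_bigr => k' _.
    by rewrite WC.
  by field.
rewrite -big_split/= mulr_sumr; apply: ler_sum => k _.
rewrite -big_split/= mulr_sumr; apply: ler_sum => k' _.
rewrite -mulrDl mulrA ler_wpM2r// -subr_ge0.
by have := sqr_ge0 (c k - c k'); lra.
Qed.

(** For z = 0 the witness is 0, hence the inequality. *)
Lemma normc_aligned (z : R[i]) : exists2 s : R[i], normc s <= 1 & s * z = (normc z)%:C.
Proof.
exists ((normc z)^-1%:C * conjc z).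
  rewrite Normc.normcM normcJ normc_real ger0_norm ?invr_ge0 ?normc_ge0//.
  have [->|z0] := eqVneq (normc z) 0; first by rewrite mulr0.
  by rewrite mulVf.
rewrite -mulrA [_ * z]mulrC -normc_sqr -rmorphM/=; congr (_%:C).
have [->|z0] := eqVneq (normc z) 0; first by rewrite expr0n/= mulr0.
by rewrite expr2 mulKf.
Qed.

(** Partial summation: ln n is the sum of the nonnegative increments of ln below n. *)
Lemma sum_ln_weight_le (z : nat -> R[i]) N (B : R) : (0 < N)%N ->
  (forall l, (0 < l)%N -> normc (\sum_(l <= n < N.+1) z n) <= B) ->
  normc (\sum_(1 <= n < N.+1) (ln n%:R)%:C * z n) <= ln N%:R * B.
Proof.
move=> N0 hB; pose d l : R := ln l.+1%:R - ln l%:R.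
have d0 l : (0 < l)%N -> 0 <= d l.
  by move=> l0; rewrite subr_ge0 ler_ln ?posrE ?ltr0n// ler_nat.
have lnE n : (0 < n)%N -> ln n%:R = \sum_(1 <= l < n) d l.
  by move=> n0; rewrite telescope_sumr// ln1 subr0.
have -> : \sum_(1 <= n < N.+1) (ln n%:R)%:C * z n =
   \sum_(1 <= l < N) (d l)%:C * \sum_(l.+1 <= n < N.+1) z n.
  transitivity (\sum_(1 <= n < N.+1) \sum_(1 <= l < N | (l < n)%N) (d l)%:C * z n).
    apply: eq_big_nat => n /andP[n0 nN]; rewrite lnE// rmorph_sum/= mulr_suml.
    by rewrite (big_nat_widen 1 n N).
  rewrite (exchange_big_dep xpredT)//=; apply: eq_big_nat => l /andP[l0 lN].
  by rewrite mulr_sumr [RHS](big_nat_widenl _ 1).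
apply: (le_trans (normc_sum _ _ _)); rewrite lnE// mulr_suml.
apply: ler_sum_nat => l /andP[l0 lN]; rewrite Normc.normcM normc_real ger0_norm ?d0//.
by rewrite ler_wpM2l ?d0// hB.
Qed.

End Inequalities.

Section Phases.
Local Open Scope complex_scope.
Variables (R : realType) (al : R) (v : nat) (Q : pred nat) (H N : nat).
Hypotheses (v0 : (0 < v)%N) (Qv : forall n, Q (n + v)%N = Q n).

(** The summand e (al h k) cut to k <= N and Q k; the cut is built in so that sums over
    products of variables can run over boxes. *)
Definition phase (h k : nat) : R[i] :=
  if (k <= N)%N && Q k then e (al * h%:R * k%:R) else 0.

Lemma Q_addM m n : Q (m * v + n)%N = Q n.
Proof. by elim: m => // m IH; rewrite mulSn -addnA addnC Qv. Qed.

Lemma phase0 h k : (N < k)%N -> phase h k = 0.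
Proof. by rewrite /phase ltnNge => /negbTE ->. Qed.

Lemma phase_sum_le h m A : (0 < m)%N -> (0 < A)%N ->
  normc (\sum_(A <= n < N.+1) phase h (m * n)) <=
  4 * v%:R * kappa (N%:R / m%:R) (delta (al * v%:R * (h * m)%:R)).
Proof.
move=> m0 A0; pose Q' n := Q (m * n)%N.
have Q'v n : Q' (n + v)%N = Q' n by rewrite /Q' mulnDr addnC Q_addM.
have -> : \sum_(A <= n < N.+1) phase h (m * n) =
    \sum_(A <= n < (N %/ m).+1 | Q' n) e (al * (h * m)%:R * n%:R).
  rewrite [RHS](big_nat_widen _ _ N.+1) ?ltnS ?leq_div// [RHS]big_mkcond.
  apply: eq_bigr => n _; rewrite /phase ltnS leq_divRL// [(n * m)%N]mulnC andbC -/(Q' n).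
  case: ifP => // _; congr e.
  by rewrite !natrM; ring.
rewrite (_ : al * v%:R * (h * m)%:R = v%:R * (al * (h * m)%:R)); last by ring.
apply: periodic_exp_sum => //.
rewrite ler_pdivlMr ?ltr0n// -natrM ler_nat.
apply: leq_trans (leq_divM N m).
by case: A A0 => // A _; rewrite subSS leq_mul2r leq_subr orbT.
Qed.

(** The cuts on m1 n and m2 n restrict n to an interval, and the two congruence
    conditions together are again periodic in n modulo v, so the correlation is a
    geometric sum. *)
Lemma phase_correlation_le h1 m1 h2 m2 D : (0 < m1)%N -> (0 < m2)%N ->
  normc (\sum_(D <= n < D.*2) phase h1 (m1 * n) * conjc (phase h2 (m2 * n))) <=
  4 * v%:R * kappa D%:R (delta (al * v%:R * ((h1 * m1)%:R - (h2 * m2)%:R))).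
Proof.
move=> m10 m20; pose Q' n := Q (m1 * n)%N && Q (m2 * n)%N.
have Q'v n : Q' (n + v)%N = Q' n.
  by rewrite /Q' !mulnDr ![(_ * n + _)%N]addnC !Q_addM.
pose T := minn D.*2 (minn (N %/ m1) (N %/ m2)).+1.
have -> : \sum_(D <= n < D.*2) phase h1 (m1 * n) * conjc (phase h2 (m2 * n)) =
    \sum_(D <= n < T | Q' n) e (al * ((h1 * m1)%:R - (h2 * m2)%:R) * n%:R).
  rewrite [RHS](big_nat_widen _ _ D.*2) ?geq_minl// [RHS]big_mkcond.
  apply: eq_big_nat => n /andP[_ nD].
  have -> : conjc (phase h2 (m2 * n)) =
      if (m2 * n <= N)%N && Q (m2 * n) then e (- (al * h2%:R * (m2 * n)%:R)) else 0.
    by rewrite /phase; case: ifP; rewrite -?eN ?eN// rmorph0.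
  rewrite /phase /T leq_min nD ltnS leq_min !leq_divRL// ![(n * _)%N]mulnC /Q' /=.
  case: (m1 * n <= N)%N; case: (m2 * n <= N)%N; case: (Q (m1 * n)); case: (Q (m2 * n));
    rewrite /= ?mul0r ?mulr0 ?andbF//.
  rewrite -eD; congr e.
  by rewrite !natrM; ring.
rewrite (_ : al * v%:R * _ = v%:R * (al * ((h1 * m1)%:R - (h2 * m2)%:R))); last by ring.
by apply: periodic_exp_sum => //; rewrite ler_nat /T; lia.
Qed.

Variables (a : int) (q L : nat).
Hypotheses (aq : coprimez a q) (q2 : (2 <= q)%N)
  (baq : `|al * v%:R - a%:~R / q%:R| <= 1 / q%:R ^+ 2)
  (qL : (2 * q <= 2 ^ L)%N) (L0 : (0 < L)%N).

(** Cauchy-Schwarz over n with the whole sum over (h, m) inside: after aligning the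
    phases of the inner sums the variable h joins m, and only the product k = h m
    matters.  Opening the square leaves sums over pairs (k, k') of kappa at the
    multiple k - k' of al v, which is where averaging over h is used. *)
Lemma typeII_block (f g : nat -> R) D M :
  (\sum_(1 <= h < H.+1) normc (\sum_(D <= n < D.*2) \sum_(1 <= m < M.+1)
      (f m * g n)%:C * phase h (m * n))) ^+ 2 <=
  (\sum_(D <= n < D.*2) g n ^+ 2) *
  (4 * v%:R * ((\sum_(1 <= k < (H * M).+1) (\sum_(1 <= m < M.+1 | (m %| k)%N) `|f m|) ^+ 2) *
    (6 * L%:R * ((H * M)%:R * D%:R / q%:R + (H * M)%:R + D%:R + q%:R)))).
Proof.
set Z := fun h => \sum_(D <= n < D.*2) \sum_(1 <= m < M.+1) (f m * g n)%:C * phase h (m * n).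
have /choice[s sP] h : exists s : R[i], normc s <= 1 /\ s * Z h = (normc (Z h))%:C.
  by have [s s1 sE] := normc_aligned (Z h); exists s.
pose P := [seq (h, m) | h <- index_iota 1 H.+1, m <- index_iota 1 M.+1].
pose c (p : nat * nat) := s p.1 * (f p.2)%:C.
pose T n := \sum_(p <- P) c p * phase p.1 (p.2 * n).
have sumP (F : nat -> nat -> R[i]) :
    \sum_(1 <= h < H.+1) \sum_(1 <= m < M.+1) F h m = \sum_(p <- P) F p.1 p.2.
  by rewrite /P big_allpairs.
have sumPR (F : nat -> nat -> R) :
    \sum_(1 <= h < H.+1) \sum_(1 <= m < M.+1) F h m = \sum_(p <- P) F p.1 p.2.
  by rewrite /P big_allpairs.
have ZE : (\sum_(1 <= h < H.+1) normc (Z h))%:C = \sum_(D <= n < D.*2) (g n)%:C * T n.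
  rewrite rmorph_sum/= (eq_bigr (fun h => s h * Z h)); last by move=> h _; rewrite (sP h).2.
  rewrite /Z; under eq_bigr do rewrite mulr_sumr; rewrite exchange_big/=.
  apply: eq_bigr => n _; rewrite /T -(sumP (fun h m => c (h, m) * phase h (m * n))) mulr_sumr.
  apply: eq_bigr => h _; rewrite !mulr_sumr; apply: eq_bigr => m _.
  by rewrite /c/= rmorphM/=; ring.
have S0 : 0 <= \sum_(1 <= h < H.+1) normc (Z h) by apply: sumr_ge0 => *; exact: normc_ge0.
have ZT : \sum_(1 <= h < H.+1) normc (Z h) <= \sum_(D <= n < D.*2) `|g n| * normc (T n).
  rewrite -[leLHS]ger0_norm// -normc_real ZE; apply: le_trans (normc_sum _ _ _) _.
  by apply: ler_sum => n _; rewrite Normc.normcM normc_real.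
apply: (@le_trans _ _ ((\sum_(D <= n < D.*2) `|g n| * normc (T n)) ^+ 2)).
  by rewrite lerXn2r ?nnegrE// (le_trans S0 ZT).
apply: (le_trans (sum_CS _ _ _)).
rewrite (eq_bigr (fun n => g n ^+ 2)); last by move=> *; rewrite real_normK ?num_real.
rewrite ler_wpM2l ?sumr_ge0// => [*|]; first exact: sqr_ge0.
pose W k k' := kappa D%:R (delta (al * v%:R * (k%:R - k'%:R))) : R.
have W0 k k' : 0 <= W k k' by rewrite kappa_ge0// delta_ge0.
(* expand |T n| ^ 2 over pairs of indices and sum over n first *)
apply: (@le_trans _ _ (\sum_(p <- P) \sum_(p' <- P)
    `|f p.2| * `|f p'.2| * (4 * v%:R * W (p.1 * p.2)%N (p'.1 * p'.2)%N))).
  have -> : \sum_(D <= n < D.*2) normc (T n) ^+ 2 =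
      normc (\sum_(D <= n < D.*2) T n * conjc (T n)).
    have -> : \sum_(D <= n < D.*2) T n * conjc (T n) = (\sum_(D <= n < D.*2) normc (T n) ^+ 2)%:C.
      by rewrite rmorph_sum/=; apply: eq_bigr => n _; rewrite -normc_sqr.
    rewrite normc_real ger0_norm//.
    by apply: sumr_ge0 => *; exact: sqr_ge0.
  have -> : \sum_(D <= n < D.*2) T n * conjc (T n) = \sum_(p <- P) \sum_(p' <- P)
      c p * conjc (c p') * \sum_(D <= n < D.*2) phase p.1 (p.2 * n) * conjc (phase p'.1 (p'.2 * n)).
    under [in RHS]eq_bigr do under eq_bigr do rewrite mulr_sumr.
    under [in RHS]eq_bigr do rewrite exchange_big/=.
    rewrite [RHS]exchange_big/=; apply: eq_bigr => n _.
    rewrite /T rmorph_sum/= big_distrlr/=; apply: eq_bigr => p _; apply: eq_bigr => p' _.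
    by rewrite rmorphM/=; ring.
  apply: le_trans (normc_sum _ _ _) _.
  rewrite big_seq [leRHS]big_seq; apply: ler_sum => p pP.
  apply: le_trans (normc_sum _ _ _) _.
  rewrite big_seq [leRHS]big_seq; apply: ler_sum => p' p'P.
  have pos p0 : p0 \in P -> (0 < p0.2)%N.
    by case/allpairsP=> -[h m]/= [_]; rewrite mem_index_iota => /andP[m0 _] ->.
  have c1 p0 : normc (c p0) <= `|f p0.2|.
    by rewrite Normc.normcM normc_real ler_piMl// (sP _).1.
  have c2 : normc (c p * conjc (c p')) <= `|f p.2| * `|f p'.2|.
    rewrite Normc.normcM normcJ.
    exact: ler_pM (normc_ge0 _) (normc_ge0 _) (c1 _) (c1 _).
  rewrite Normc.normcM; apply: ler_pM (normc_ge0 _) (normc_ge0 _) c2 _.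
  exact: phase_correlation_le (pos _ pP) (pos _ p'P).
pose C k : R := \sum_(1 <= m < M.+1 | (m %| k)%N) `|f m|.
have C0 k : 0 <= C k by apply: sumr_ge0.
apply: (@le_trans _ _ (4 * v%:R * \sum_(1 <= k < (H * M).+1)
    \sum_(1 <= k' < (H * M).+1) C k * C k' * W k k')).
  have -> : \sum_(p <- P) \sum_(p' <- P)
    `|f p.2| * `|f p'.2| * (4 * v%:R * W (p.1 * p.2)%N (p'.1 * p'.2)%N) =
    4 * v%:R * \sum_(1 <= h < H.+1) \sum_(1 <= m < M.+1) `|f m| *
      \sum_(1 <= h' < H.+1) \sum_(1 <= m' < M.+1) `|f m'| * W (h * m)%N (h' * m')%N.
    rewrite (sumPR (fun h m => `|f m| * \sum_(1 <= h' < H.+1)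
       \sum_(1 <= m' < M.+1) `|f m'| * W (h * m)%N (h' * m')%N)) mulr_sumr.
    apply: eq_bigr => p _.
    rewrite (sumPR (fun h' m' => `|f m'| * W (p.1 * p.2)%N (h' * m')%N)) !mulr_sumr.
    by apply: eq_bigr => p' _; ring.
  rewrite ler_wpM2l ?mulr_ge0//.
  apply: (@le_trans _ _ (\sum_(1 <= h < H.+1) \sum_(1 <= m < M.+1) `|f m| *
     \sum_(1 <= k' < (H * M).+1) C k' * W (h * m)%N k')).
    apply: ler_sum => h _; apply: ler_sum => m _; rewrite ler_wpM2l//.
    exact: (@collect_products _ (fun m' => `|f m'|) (fun k' => W (h * m)%N k')).
  apply: le_trans (@collect_products _ (fun m => `|f m|)
     (fun k => \sum_(1 <= k' < (H * M).+1) C k' * W k k') _ _ _ _) _ => //.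
    by move=> k; apply: sumr_ge0 => *; rewrite mulr_ge0.
  apply: ler_sum => k _; rewrite mulr_sumr; apply: ler_sum => k' _.
  by rewrite mulrA.
rewrite ler_wpM2l ?mulr_ge0//; apply: sum_symmetric_le => //.
  by move=> k k'; rewrite /W -deltaN; congr (kappa _ (delta _)); ring.
move=> k /andP[k0 kK].
have D0 : 0 <= D%:R :> R by [].
apply: le_trans (sum_kappa_le aq q2 baq (al * v%:R * (1 - k%:R)) (H * M) D0 qL L0).
rewrite big_add1/= big_mkord; apply: ler_sum => i _.
rewrite /W -deltaN le_eqVlt; apply/orP; left; apply/eqP.
by congr (kappa _ (delta _)); rewrite -natr1; ring.
Qed.

End Phases.

(** * Bilinear sums *)

Lemma le_sqrt_sq (R : realType) (S X : R) : 0 <= S -> S ^+ 2 <= X -> S <= Num.sqrt X.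
Proof. by move=> S0 SX; rewrite -[leLHS]ger0_norm// -sqrtr_sqr ler_wsqrtr. Qed.

Section TypeII.
Local Open Scope complex_scope.
Variables (R : realType) (al : R) (v : nat) (Q : pred nat) (H N : nat).
Hypotheses (v0 : (0 < v)%N) (Qv : forall n, Q (n + v)%N = Q n).
Variables (a : int) (q J : nat).
Hypotheses (aq : coprimez a q) (q2 : (2 <= q)%N)
  (baq : `|al * v%:R - a%:~R / q%:R| <= 1 / q%:R ^+ 2)
  (qJ : (2 * q <= 2 ^ J)%N) (J0 : (0 < J)%N) (NJ : (N < 2 ^ J)%N).
Local Notation phase := (phase al Q N).

(** The sum of the squares of the first four terms of the final bound, when x and Y
    stand for N ^ (1 / 2) and N ^ (2 / 3). *)
Definition majorant (x Y : nat) : R :=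
  (H * N)%:R ^+ 2 / q%:R + H%:R ^+ 2 * N%:R * x%:R + (H * N)%:R * Y%:R + (H * N)%:R * q%:R.

Lemma majorant_ge0 x Y : 0 <= majorant x Y.
Proof. by rewrite !addr_ge0// ?mulr_ge0// ?divr_ge0 ?sqr_ge0. Qed.

(** Split n into dyadic blocks [D, 2 D).  The cut m n <= N lets m run up to
    min (x, N / D) only, so that all four terms of the block bound fit in the majorant:
    D M <= N bounds every product of lengths, M <= x the term in M and D <= Y the term
    in D. *)
Lemma typeII_dyadic (f g : nat -> R) (A B : R) x Y : 0 <= A -> 0 <= B ->
  (forall M, (M <= x)%N -> \sum_(1 <= k < (H * M).+1)
     (\sum_(1 <= m < M.+1 | (m %| k)%N) `|f m|) ^+ 2 <= (H * M)%:R * A) ->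
  (forall j, (j < J)%N -> \sum_(2 ^ j <= n < (2 ^ j).*2) g n ^+ 2 <= (2 ^ j)%:R * B) ->
  (forall n, (Y <= n)%N -> g n = 0) ->
  \sum_(1 <= h < H.+1) normc (\sum_(1 <= n < N.+1) \sum_(1 <= m < x.+1)
      (f m * g n)%:C * phase h (m * n)) <=
  J%:R * Num.sqrt (24 * v%:R * J%:R * A * B * majorant x Y).
Proof.
move=> A0 B0 hA hB gY.
pose Z h n := \sum_(1 <= m < x.+1) (f m * g n)%:C * phase h (m * n).
have ZE h : \sum_(1 <= n < N.+1) Z h n = \sum_(j < J) \sum_(2 ^ j <= n < (2 ^ j).*2) Z h n.
  have -> : \sum_(1 <= n < N.+1) Z h n = \sum_(1 <= n < 2 ^ J) Z h n.
    rewrite [RHS](big_cat_nat (n := N.+1))//= [X in _ + X]big_nat [X in _ + X]big1 ?addr0// => n /andP[Nn _].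
    rewrite /Z big_nat big1// => m /andP[m0 _]; rewrite phase0 ?mulr0//.
    by apply: leq_trans Nn _; exact: leq_pmull.
  by rewrite sum_dyadic; apply: eq_bigr => j _; rewrite expnS mul2n.
apply: (@le_trans _ _ (\sum_(j < J) \sum_(1 <= h < H.+1)
    normc (\sum_(2 ^ j <= n < (2 ^ j).*2) Z h n))).
  rewrite exchange_big/=; apply: ler_sum => h _.
  by rewrite -/(Z _ _) ZE; exact: normc_sum.
set X := Num.sqrt _.
rewrite [leRHS](_ : _ = \sum_(j < J) X); last by rewrite sumr_const card_ord mulr_natl.
apply: ler_sum => j _; set D := (2 ^ j)%N.
have D0 : (0 < D)%N by rewrite expn_gt0.
have [YD|DY] := leqP Y D.
  rewrite big1 ?sqrtr_ge0// => h _.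
  rewrite big_nat big1 ?Normc.normc0// => n /andP[Dn _].
  by rewrite /Z big1// => m _; rewrite gY ?mulr0 ?mul0r// (leq_trans YD).
apply: le_sqrt_sq; first by apply: sumr_ge0 => *; exact: normc_ge0.
pose M := minn x (N %/ D).
have Mx : (M <= x)%N by exact: geq_minl.
have DM : (D * M <= N)%N.
  by rewrite mulnC -leq_divRL//; exact: geq_minr.
have -> : \sum_(1 <= h < H.+1) normc (\sum_(D <= n < D.*2) Z h n) =
  \sum_(1 <= h < H.+1) normc (\sum_(D <= n < D.*2) \sum_(1 <= m < M.+1)
      (f m * g n)%:C * phase h (m * n)).
  apply: eq_bigr => h _; congr normc; apply: eq_big_nat => n /andP[Dn _].
  rewrite /Z (big_cat_nat (n := M.+1))//= [X in _ + X]big_nat [X in _ + X]big1 ?addr0//.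
  move=> m /andP[Mm mx]; rewrite phase0 ?mulr0//.
  have : (N %/ D < m)%N by move: Mm; rewrite /M; lia.
  rewrite ltn_divLR// => /leq_trans; apply.
  by rewrite leq_mul2l Dn orbT.
apply: (le_trans (typeII_block H N v0 Qv aq q2 baq qJ J0 f g D M)).
set h := H%:R : R; set n := N%:R : R; set d := D%:R : R; set m := M%:R : R.
have q0 : 0 < q%:R :> R by rewrite ltr0n; lia.
have h0 : 0 <= h by []. have n0 : 0 <= n by []. have d0 : 0 <= d by [].
have m0 : 0 <= m by [].
have dm : d * m <= n by rewrite -natrM ler_nat.
have mx : m <= x%:R by rewrite ler_nat.
have dY : d <= Y%:R by rewrite ler_nat ltnW.
have b1 := hA M Mx; have b2 := hB j (ltn_ord j).
have hdm : h * (d * m) <= h * n by rewrite ler_wpM2l.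
have hdm0 : 0 <= h * (d * m) by rewrite !mulr_ge0.
have hn0 : 0 <= h * n by rewrite !mulr_ge0.
set E := 6 * J%:R * _.
have E0 : 0 <= E by rewrite !mulr_ge0// !addr_ge0// divr_ge0// mulr_ge0.
apply: (@le_trans _ _ ((d * B) * (4 * v%:R * (((H * M)%:R * A) * E)))).
  apply: ler_pM => //; first by apply: sumr_ge0 => *; exact: sqr_ge0.
    apply: mulr_ge0; first by rewrite mulr_ge0.
    by apply: mulr_ge0 => //; apply: sumr_ge0 => *; exact: sqr_ge0.
  by rewrite ler_wpM2l ?mulr_ge0// ler_wpM2r.
rewrite (_ : _ * _ = 24 * v%:R * J%:R * A * B *
   ((h * (d * m)) * (h * (d * m)) / q%:R + (h * (d * m)) * (h * m) +
    (h * (d * m)) * d + (h * (d * m)) * q%:R)); last first.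
  by rewrite /E natrM -/h -/m; field; rewrite lt0r_neq0.
rewrite ler_wpM2l ?mulr_ge0// /majorant natrM -/h -/n.
apply: lerD; last by rewrite ler_wpM2r// ltW.
apply: lerD; last by apply: ler_pM.
apply: lerD; first by rewrite expr2 ler_wpM2r ?invr_ge0 ?(ltW q0)//; exact: ler_pM.
have -> : h ^+ 2 * n * x%:R = (h * n) * (h * x%:R) by ring.
by apply: ler_pM; rewrite ?mulr_ge0// ler_wpM2l.
Qed.

(** In a product m n <= N one factor is at most x, roughly the square root of N; the
    other one, at most N ^ (2 / 3) by the support hypothesis, plays the role of the
    variable n in the dyadic bound.  The worse case is that where g is over the smooth
    variable: under the square root, J ^ 8 comes from tau, averaged over multiples, J ^ 2
    from g and J from the harmonic sums, and the dyadic splitting costs another J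
    outside. *)
Lemma typeII_sum (f g : nat -> R) x Y : (N < x.+1 ^ 2)%N -> (x <= N)%N ->
  (forall m, (0 < m)%N -> `|f m| <= tau R m) ->
  (forall n, (0 < n <= N)%N -> `|g n| <= J%:R) ->
  (forall m, (Y <= m)%N -> f m = 0) -> (forall n, (Y <= n)%N -> g n = 0) ->
  \sum_(1 <= h < H.+1) normc (\sum_(1 <= m < N.+1) \sum_(1 <= n < N.+1)
      (f m * g n)%:C * phase h (m * n)) <=
  2 * J%:R ^+ 7 * Num.sqrt (48 * v%:R * majorant x Y).
Proof.
move=> Nx xN ftau gJ fY gY.
have J1 : 1 <= J%:R :> R by rewrite ler1n.
have xJ : (x < 2 ^ J)%N by exact: leq_ltn_trans NJ.
pose g' n := if (x < n <= N)%N then g n else 0.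
(* the part n <= x, with the variables renamed, and the part n > x, where m <= x *)
have split h : \sum_(1 <= m < N.+1) \sum_(1 <= n < N.+1) (f m * g n)%:C * phase h (m * n)
  = \sum_(1 <= n < N.+1) \sum_(1 <= m < x.+1) (g m * f n)%:C * phase h (m * n) +
    \sum_(1 <= n < N.+1) \sum_(1 <= m < x.+1) (f m * g' n)%:C * phase h (m * n).
  have -> : \sum_(1 <= n < N.+1) \sum_(1 <= m < x.+1) (f m * g' n)%:C * phase h (m * n)
     = \sum_(1 <= m < N.+1) \sum_(x.+1 <= n < N.+1) (f m * g n)%:C * phase h (m * n).
    rewrite [RHS]exchange_big/= [LHS](big_cat_nat (n := x.+1))//= [X in X + _]big_nat.
    rewrite [X in X + _]big1 ?add0r; last first.
      move=> n /andP[_ nx]; rewrite big1// => m _.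
      by rewrite /g' ltnNge -ltnS nx/= mulr0 mul0r.
    apply: eq_big_nat => n /andP[xn nN].
    rewrite [RHS](big_cat_nat (n := x.+1))//= [X in _ + X]big_nat [X in _ + X]big1 ?addr0.
      by apply: eq_bigr => m _; rewrite /g' xn -ltnS nN.
    move=> m /andP[xm mN]; rewrite phase0 ?mulr0//.
    by apply: leq_trans Nx _; rewrite expnS expn1 leq_mul.
  rewrite -big_split/=; apply: eq_bigr => m _.
  rewrite (big_cat_nat (n := x.+1))//=; congr (_ + _).
  by apply: eq_bigr => n _; rewrite [(n * m)%N]mulnC [g n * _]mulrC.
under eq_bigr do rewrite split.
apply: (@le_trans _ _ (\sum_(1 <= h < H.+1)
   normc (\sum_(1 <= n < N.+1) \sum_(1 <= m < x.+1) (g m * f n)%:C * phase h (m * n)) +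
   \sum_(1 <= h < H.+1)
   normc (\sum_(1 <= n < N.+1) \sum_(1 <= m < x.+1) (f m * g' n)%:C * phase h (m * n)))).
  by rewrite -big_split/=; apply: ler_sum => h _; exact: le_normcD.
have Jpow i j : (i <= j)%N -> J%:R ^+ i <= J%:R ^+ j :> R by move=> ij; rewrite ler_weXn2l.
(* logarithms under the root, at most J ^ 12, come out as J ^ 6 *)
have small P : 0 <= P -> P <= J%:R ^+ 12 ->
  J%:R * Num.sqrt (48 * v%:R * P * majorant x Y) <= J%:R ^+ 7 * Num.sqrt (48 * v%:R * majorant x Y).
  move=> P0 PJ; rewrite (exprS _ 6) -[leRHS]mulrA; apply: ler_wpM2l => //.
  have -> : J%:R ^+ 6 = Num.sqrt (J%:R ^+ 12) :> R.
    by rewrite (exprM _ 6 2) sqrtr_sqr ger0_norm ?exprn_ge0.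
  rewrite -sqrtrM ?exprn_ge0// ler_wsqrtr//.
  rewrite [leLHS](_ : _ = P * (48 * v%:R * majorant x Y)); last by ring.
  by rewrite ler_wpM2r// !mulr_ge0// majorant_ge0.
set T := Num.sqrt _ in small *.
rewrite [leRHS](_ : _ = J%:R ^+ 7 * T + J%:R ^+ 7 * T); last by ring.
apply: lerD.
- apply: le_trans (@typeII_dyadic g f (J%:R ^+ 5) (2 * J%:R ^+ 3) x Y _ _ _ _ fY) _.
  + by rewrite exprn_ge0.
  + by rewrite mulr_ge0// exprn_ge0.
  + move=> M Mx; have MJ : (M < 2 ^ J)%N by exact: leq_ltn_trans xJ.
    have sub1 : submul (fun=> 1 : R) by move=> *; rewrite mulr1.
    have := sq_divisor_sum_le (H * M) M (fun=> ler01) sub1.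
    have hM := harmonic_le R MJ.
    have hM0 : 0 <= \sum_(1 <= n < M.+1) (n%:R)^-1 :> R by apply: sum_nat_ge0 => i; rewrite invr_ge0.
    have -> : \sum_(1 <= d < M.+1) 1 ^+ 2 / d%:R = \sum_(1 <= n < M.+1) (n%:R)^-1 :> R.
      by apply: eq_bigr => *; rewrite expr1n mul1r.
    have -> : \sum_(1 <= d < M.+1) 1 / d%:R = \sum_(1 <= n < M.+1) (n%:R)^-1 :> R.
      by apply: eq_bigr => *; rewrite mul1r.
    move=> h.
    apply: (@le_trans _ _ (J%:R ^+ 2 * \sum_(1 <= k < (H * M).+1)
       (\sum_(1 <= m < M.+1 | (m %| k)%N) 1) ^+ 2)).
      rewrite mulr_sumr; apply: ler_sum => k _; rewrite -exprMn.
      rewrite lerXn2r ?nnegrE ?mulr_ge0 ?sumr_ge0//.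
      rewrite mulr_sumr big_nat_cond [leRHS]big_nat_cond.
      apply: ler_sum => m /andP[/andP[m0 mM] _]; rewrite mulr1 gJ// m0/=.
      by apply: leq_trans xN; apply: leq_trans Mx.
    have -> : (H * M)%:R * J%:R ^+ 5 = J%:R ^+ 2 * ((H * M)%:R * J%:R ^+ 3) :> R by ring.
    rewrite ler_wpM2l ?exprn_ge0//; apply: (le_trans h).
    by rewrite -mulrA -exprS ler_wpM2l// lerXn2r ?nnegrE.
  + move=> j jJ; have p : (0 < 2 ^ j)%N by rewrite expn_gt0.
    apply: (@le_trans _ _ (\sum_(1 <= n < ((2 ^ j).*2.-1).+1) tau R n ^+ 2)).
      rewrite prednK ?double_gt0//.
      rewrite [leRHS](big_cat_nat (n := 2 ^ j))//=; last by rewrite -addnn leq_addr.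
      rewrite -[leLHS]add0r; apply: lerD; first by apply: sumr_ge0 => *; exact: sqr_ge0.
      apply: ler_sum_nat => n /andP[jn _].
      rewrite -[leLHS]real_normK ?num_real// lerXn2r ?nnegrE ?tau_ge0//.
      by apply: ftau; exact: leq_trans jn.
    have lt2 : ((2 ^ j).*2.-1 < 2 ^ J)%N.
      by rewrite prednK ?double_gt0// -mul2n -expnS leq_exp2l.
    apply: le_trans (sum_tau_sq_le R lt2) _.
    rewrite mulrA ler_wpM2r ?exprn_ge0// mulrC -natrM ler_nat.
    by rewrite mul2n leq_pred.
  apply: le_trans (small (J%:R ^+ 9) _ (Jpow _ _ _)) => //.
  rewrite ler_wpM2l// ler_wsqrtr// le_eqVlt; apply/orP; left; apply/eqP.
  by ring.
- apply: le_trans (@typeII_dyadic f g' (2 * J%:R ^+ 8) (J%:R ^+ 2) x Y _ _ _ _ _) _.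
  + by rewrite mulr_ge0// exprn_ge0.
  + by rewrite exprn_ge0.
  + move=> M Mx; have MJ : (M < 2 ^ J)%N by exact: leq_ltn_trans xJ.
    have h := sq_divisor_sum_le (H * M) M (@tau_ge0 R) (@submul_tau R).
    apply: (@le_trans _ _ (\sum_(1 <= k < (H * M).+1)
       (\sum_(1 <= m < M.+1 | (m %| k)%N) tau R m) ^+ 2)).
      apply: ler_sum => k _.
      rewrite lerXn2r ?nnegrE ?sumr_ge0//.
      rewrite big_nat_cond [leRHS]big_nat_cond.
      by apply: ler_sum => m /andP[/andP[m0 mM] _]; rewrite ftau.
    apply: (le_trans h); rewrite -mulrA ler_wpM2l//.
    have -> : 2 * J%:R ^+ 8 = 2 * J%:R ^+ 4 * (J%:R ^+ 2) ^+ 2 :> R by ring.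
    have t0 : 0 <= \sum_(1 <= m < M.+1) tau R m / m%:R.
      by apply: sumr_ge0 => *; rewrite divr_ge0 ?tau_ge0.
    apply: ler_pM; rewrite ?sqr_ge0//.
    * by apply: sumr_ge0 => *; rewrite divr_ge0 ?sqr_ge0.
    * exact: sum_tau_sq_div_le.
    * by rewrite lerXn2r ?nnegrE ?sqr_ge0// sum_tau_div_le.
  + move=> j jJ; have p : (0 < 2 ^ j)%N by rewrite expn_gt0.
    apply: (@le_trans _ _ (\sum_(2 ^ j <= n < (2 ^ j).*2) J%:R ^+ 2)).
      apply: ler_sum_nat => n /andP[jn _]; rewrite /g'; case: ifP => [|_].
        move=> /andP[xn nN]; rewrite -[leLHS]real_normK ?num_real//.
        by rewrite lerXn2r ?nnegrE// gJ// nN andbT (leq_trans _ xn).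
      by rewrite expr0n/= sqr_ge0.
    by rewrite sum_const_nat -addnn addnK.
  + by move=> n Yn; rewrite /g' gY//; case: ifP.
  apply: le_trans (small (J%:R ^+ 11) _ (Jpow _ _ _)) => //.
  rewrite ler_wpM2l// ler_wsqrtr// le_eqVlt; apply/orP; left; apply/eqP.
  by ring.
Qed.

End TypeII.

(** * Linear sums *)

Section TypeI.
Local Open Scope complex_scope.
Variables (R : realType) (al : R) (v : nat) (Q : pred nat) (H N : nat).
Hypotheses (v0 : (0 < v)%N) (Qv : forall n, Q (n + v)%N = Q n).
Variables (a : int) (q J : nat).
Hypotheses (aq : coprimez a q) (q2 : (2 <= q)%N)
  (baq : `|al * v%:R - a%:~R / q%:R| <= 1 / q%:R ^+ 2)
  (qJ : (2 * q <= 2 ^ J)%N) (J0 : (0 < J)%N) (HNJ : (H * N < 2 ^ J)%N).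
Local Notation phase := (phase al Q N).
Local Notation majorant := (majorant R H N q).

(** Group by the product i = h m, whose multiplicity is at most tau i, and split
    tau kappa as (tau sqrt kappa) * sqrt kappa: the first factor is bounded trivially by
    kappa <= H N / i, so that the divisor function costs only logarithms, and the
    second one has no weight. *)
Lemma typeI_kappa_sum x y Y : (y <= x)%N -> (y <= N)%N ->
  \sum_(1 <= h < H.+1) \sum_(1 <= m < y.+1)
    kappa (N%:R / m%:R) (delta (al * v%:R * (h * m)%:R)) <=
  4 * J%:R ^+ 3 * Num.sqrt (majorant x Y).
Proof.
move=> yx yN; set b := al * v%:R; pose X : R := (H * N)%:R.
have X0 : 0 <= X by [].
have q0 : 0 < q%:R :> R by rewrite ltr0n; lia.
have J1 : 1 <= J%:R :> R by rewrite ler1n.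
pose k k : R := kappa (X / k%:R) (delta (b * k%:R)).
have k0 i : 0 <= k i by rewrite kappa_ge0 ?delta_ge0// divr_ge0.
apply: (@le_trans _ _ (\sum_(1 <= i < (H * y).+1) tau R i * k i)).
  apply: (@le_trans _ _ (\sum_(1 <= h < H.+1) \sum_(1 <= m < y.+1) 1 * k (h * m)%N)).
    apply: ler_sum_nat => h /andP[h0 hH]; apply: ler_sum_nat => m /andP[m0 my].
    rewrite mul1r /k; apply: kappa_le; rewrite ?delta_ge0 ?divr_ge0//.
    rewrite /X !natrM ler_pdivrMr ?ltr0n// [leRHS](_ : _ = H%:R / h%:R * N%:R); last first.
      by field; rewrite !pnatr_eq0 !gt_eqF.
    by rewrite ler_peMl// ler_pdivlMr ?ltr0n// mul1r ler_nat.
  apply: (le_trans (collect_products H y (fun=> ler01) k0)).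
  apply: ler_sum_nat => i /andP[i0 iK]; rewrite ler_wpM2r//.
  rewrite (@tauE _ (maxn y i) i) ?i0 ?leq_maxr// big_mkcond [leRHS]big_mkcond/=.
  by apply: sum_nat_widen; [move=> j; case: ifP|rewrite ltnS leq_maxl].
have yJ : (H * y < 2 ^ J)%N by apply: leq_ltn_trans HNJ; rewrite leq_mul2l yN orbT.
have T1 : \sum_(1 <= i < (H * y).+1) (tau R i * Num.sqrt (k i)) ^+ 2 <= X * (2 * J%:R ^+ 4).
  apply: (@le_trans _ _ (\sum_(1 <= i < (H * y).+1) X * (tau R i ^+ 2 / i%:R))).
    apply: ler_sum_nat => i /andP[i0 _]; rewrite exprMn sqr_sqrtr// [leRHS]mulrCA ler_wpM2l ?sqr_ge0//.
    by apply: kappa_leD; rewrite ?delta_ge0 ?divr_ge0.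
  by rewrite -mulr_sumr ler_wpM2l// sum_tau_sq_div_le.
have T2 : \sum_(1 <= i < (H * y).+1) Num.sqrt (k i) ^+ 2 <=
    8 * J%:R * (X / q%:R + (H * y)%:R + q%:R).
  rewrite (eq_bigr k); last by move=> i _; rewrite sqr_sqrtr.
  exact: sum_kappa_hyperbola aq q2 baq _ _ _ X0 yJ qJ J0.
have -> : 4 * J%:R ^+ 3 * Num.sqrt (majorant x Y) =
   Num.sqrt (16 * J%:R ^+ 6 * majorant x Y).
  rewrite [in RHS]sqrtrM ?mulr_ge0 ?exprn_ge0//; congr (_ * _).
  rewrite (_ : 16 * J%:R ^+ 6 = (4 * J%:R ^+ 3) ^+ 2); last by ring.
  by rewrite sqrtr_sqr ger0_norm// mulr_ge0// exprn_ge0.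
apply: le_sqrt_sq; first by apply: sumr_ge0 => *; rewrite mulr_ge0// tau_ge0.
have -> : \sum_(1 <= i < (H * y).+1) tau R i * k i =
    \sum_(1 <= i < (H * y).+1) (tau R i * Num.sqrt (k i)) * Num.sqrt (k i).
  by apply: eq_bigr => i _; rewrite -mulrA -expr2 sqr_sqrtr.
apply: (le_trans (sum_CS _ _ _)).
apply: (@le_trans _ _ (X * (2 * J%:R ^+ 4) * (8 * J%:R * (X / q%:R + (H * y)%:R + q%:R)))).
  by apply: ler_pM => //; apply: sumr_ge0 => *; rewrite sqr_ge0.
have JJ : J%:R ^+ 5 <= J%:R ^+ 6 :> R by rewrite ler_weXn2l.
have M1 : X * (X / q%:R + (H * y)%:R + q%:R) <= majorant x Y.
  rewrite /majorant -/X !mulrDr.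
  have e1 : X * (X / q%:R) = X ^+ 2 / q%:R by ring.
  have e2 : X * (H * y)%:R <= H%:R ^+ 2 * N%:R * x%:R.
    rewrite /X [leRHS](_ : _ = (H * N)%:R * (H * x)%:R); last by rewrite !natrM; ring.
    by rewrite -!natrM ler_nat !leq_mul.
  have e3 : 0 <= X * Y%:R by rewrite mulr_ge0.
  by rewrite e1; lra.
have M0 : 0 <= X * (X / q%:R + (H * y)%:R + q%:R).
  by rewrite mulr_ge0// !addr_ge0// divr_ge0.
rewrite [leLHS](_ : _ = 16 * (J%:R ^+ 5 * (X * (X / q%:R + (H * y)%:R + q%:R)))); last by ring.
rewrite -[leRHS]mulrA ler_wpM2l//; apply: ler_pM; rewrite ?exprn_ge0//.
Qed.

(** The hypothesis on g holds with B = 1 for g = 1 and with B = ln N for g = ln. *)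
Lemma typeI_sum (f g : nat -> R) (A B : R) x y Y : (y <= x)%N -> (y <= N)%N ->
  0 <= A -> 0 <= B ->
  (forall m, (0 < m <= y)%N -> `|f m| <= A) ->
  (forall (z : nat -> R[i]) (C : R),
    (forall l, (0 < l)%N -> normc (\sum_(l <= n < N.+1) z n) <= C) ->
    normc (\sum_(1 <= n < N.+1) (g n)%:C * z n) <= B * C) ->
  \sum_(1 <= h < H.+1) normc (\sum_(1 <= m < y.+1) \sum_(1 <= n < N.+1)
      (f m * g n)%:C * phase h (m * n)) <=
  16 * v%:R * A * B * J%:R ^+ 3 * Num.sqrt (majorant x Y).
Proof.
move=> yx yN A0 B0 fA gB.
apply: (@le_trans _ _ (\sum_(1 <= h < H.+1) \sum_(1 <= m < y.+1)
   A * (B * (4 * v%:R * kappa (N%:R / m%:R) (delta (al * v%:R * (h * m)%:R)))))).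
  apply: ler_sum => h _; apply: (le_trans (normc_sum _ _ _)).
  apply: ler_sum_nat => m /andP[m0 my].
  have -> : \sum_(1 <= n < N.+1) (f m * g n)%:C * phase h (m * n) =
      (f m)%:C * \sum_(1 <= n < N.+1) (g n)%:C * phase h (m * n).
    by rewrite mulr_sumr; apply: eq_bigr => n _; rewrite rmorphM/= mulrA.
  rewrite Normc.normcM normc_real; apply: ler_pM; rewrite ?normc_ge0 ?fA ?m0//.
  by apply: gB => l l0; exact: phase_sum_le.
have -> : 16 * v%:R * A * B * J%:R ^+ 3 * Num.sqrt (majorant x Y) =
   A * B * (4 * v%:R) * (4 * J%:R ^+ 3 * Num.sqrt (majorant x Y)) by ring.
apply: le_trans (ler_wpM2l _ (typeI_kappa_sum Y yx yN)); last by rewrite !mulr_ge0.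
rewrite mulr_sumr; apply: ler_sum => h _; rewrite mulr_sumr; apply: ler_sum => m _.
by rewrite !mulrA.
Qed.

End TypeI.

(** * Vaughan's identity *)

Section Vaughan.
Local Open Scope complex_scope.
Variables (R : realType) (N : nat).
Hypothesis N0 : (0 < N)%N.
Implicit Types (f g : nat -> R) (psi : nat -> complex R).

Lemma mangoldt_ge0 n : 0 <= mangoldt R n.
Proof.
rewrite /mangoldt; case E: (primes n) => [//|p [|//]]; apply: ln_ge0.
have : p \in primes n by rewrite E mem_head.
by rewrite mem_primes ler1n => /andP[/prime_gt0].
Qed.

Lemma mangoldt_le_ln n : (0 < n)%N -> mangoldt R n <= ln n%:R.
Proof.
move=> n0; rewrite -dsum_mangoldt// -(sum_dvdn _ (N := n)) ?n0 ?leqnn// big_mkcond/=.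
have -> : mangoldt R n = if (n %| n)%N then mangoldt R n else 0 by rewrite dvdnn.
apply: (@single_le_sum R (fun i => if (i %| n)%N then mangoldt R i else 0)).
  by move=> i; case: ifP => // _; exact: mangoldt_ge0.
by rewrite n0 ltnS leqnn.
Qed.

Lemma sum_divisors_psi f psi : (forall k, (N < k)%N -> psi k = 0) ->
  \sum_(1 <= m < N.+1) \sum_(1 <= n < N.+1) (f m)%:C * psi (m * n)%N =
  \sum_(1 <= k < N.+1) (\sum_(d <- divisors k) f d)%:C * psi k.
Proof.
move=> psi0.
transitivity (\sum_(1 <= m < N.+1) \sum_(1 <= n < N.+1)
   \sum_(1 <= k < N.+1 | k == (m * n)%N) (f m)%:C * psi k).
  apply: eq_big_nat => m /andP[m0 mN]; apply: eq_big_nat => n /andP[n0 nN].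
  rewrite big_nat1_eq muln_gt0 m0 n0/= ltnS; case: leqP => // /psi0 ->.
  by rewrite mulr0.
under eq_bigr do rewrite (exchange_big_dep xpredT)//=.
rewrite exchange_big/=; apply: eq_big_nat => k /andP[k0 kN].
rewrite -(sum_dvdn _ (N := N)) ?k0// rmorph_sum/= mulr_suml [RHS]big_mkcond/=.
by apply: eq_big_nat => m /andP[m0 mN]; rewrite sum_mul_eq// k0.
Qed.

(** Dirichlet convolution, computed inside a box; exact for k <= N. *)
Definition dconv f g k : R := \sum_(1 <= m < N.+1) \sum_(1 <= n < N.+1 | k == (m * n)%N) f m * g n.

Lemma sum_dconv f g (F : nat -> R[i]) : (forall k, (N < k)%N -> F k = 0) ->
  \sum_(1 <= m < N.+1) \sum_(1 <= n < N.+1) (f m * g n)%:C * F (m * n)%N =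
  \sum_(1 <= k < N.+1) (dconv f g k)%:C * F k.
Proof.
move=> F0.
transitivity (\sum_(1 <= m < N.+1) \sum_(1 <= n < N.+1)
   \sum_(1 <= k < N.+1 | k == (m * n)%N) (f m * g n)%:C * F k).
  apply: eq_big_nat => m /andP[m0 mN]; apply: eq_big_nat => n /andP[n0 nN].
  rewrite big_nat1_eq muln_gt0 m0 n0/= ltnS; case: leqP => // /F0 ->.
  by rewrite mulr0.
under eq_bigr do rewrite (exchange_big_dep xpredT)//=.
rewrite exchange_big/=; apply: eq_bigr => k _.
rewrite /dconv rmorph_sum mulr_suml; apply: eq_bigr => m _.
by rewrite rmorph_sum mulr_suml.
Qed.

Definition low y f n : R := if (n <= y)%N then f n else 0.
Definition high y f n : R := if (n <= y)%N then 0 else f n.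

Lemma low_high y f n : f n = low y f n + high y f n.
Proof. by rewrite /low /high; case: ifP; rewrite ?addr0 ?add0r. Qed.

Local Notation Lam := (mangoldt R).
Local Notation mu := (mobius R).

(** Vaughan's identity, for sums against an arbitrary psi that vanishes beyond N.  Write
    Lam = L1 + L2 and mu = m1 + m2, cutting at y.  Since mu * 1 is the unit of Dirichlet
    convolution, L2 = m1 * 1 * L2 + m2 * 1 * L2.  The last term is bilinear with both
    variables above y; in the first one L2 = Lam - L1 and 1 * Lam = ln. *)
Lemma vaughan y psi : (forall k, (N < k)%N -> psi k = 0) ->
  \sum_(1 <= n < N.+1) (Lam n)%:C * psi n =
  \sum_(1 <= n < N.+1) (low y Lam n)%:C * psi n +
  \sum_(1 <= m < N.+1) \sum_(1 <= n < N.+1) (low y mu m * ln n%:R)%:C * psi (m * n)%N -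
  \sum_(1 <= k < N.+1) \sum_(1 <= l < N.+1)
    (dconv (low y mu) (low y Lam) k)%:C * psi (k * l)%N +
  \sum_(1 <= k < N.+1) \sum_(1 <= n < N.+1)
    ((\sum_(d <- divisors k) high y mu d) * high y Lam n)%:C * psi (k * n)%N.
Proof.
move=> psi0.
have psi0M m k : (0 < m)%N -> (N < k)%N -> psi (k * m)%N = 0.
  by move=> m0 Nk; apply: psi0; apply: leq_trans Nk _; exact: leq_pmulr.
have -> : \sum_(1 <= n < N.+1) (Lam n)%:C * psi n =
   \sum_(1 <= n < N.+1) (low y Lam n)%:C * psi n +
   \sum_(1 <= n < N.+1) (high y Lam n)%:C * psi n.
  rewrite -big_split/=; apply: eq_bigr => n _.
  by rewrite {1}(low_high y Lam n) rmorphD/= mulrDl.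
rewrite -!addrA; congr (_ + _).
(* the unit mu * 1, applied to k |-> psi (k n), with mu cut at y *)
have E n : (1 <= n < N.+1)%N -> psi n = \sum_(1 <= m < N.+1) \sum_(1 <= l < N.+1)
    (low y mu m)%:C * psi (m * l * n)%N +
    \sum_(1 <= k < N.+1) (\sum_(d <- divisors k) high y mu d)%:C * psi (k * n)%N.
  move=> /andP[n0 nN].
  rewrite -(@sum_divisors_psi _ (fun k => psi (k * n)%N)); last by move=> k; exact: psi0M.
  rewrite -big_split/=.
  transitivity (\sum_(1 <= m < N.+1) \sum_(1 <= l < N.+1) (mu m)%:C * psi (m * l * n)%N).
    rewrite (@sum_divisors_psi mu (fun k => psi (k * n)%N)); last by move=> k; exact: psi0M.
    rewrite big_ltn ?ltnS// dsum_mobius// mul1n mul1r.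
    rewrite big_nat big1 ?addr0// => k /andP[k1 _].
    by rewrite dsum_mobius 1?ltnW// (gtn_eqF k1) mul0r.
  apply: eq_bigr => m _; rewrite -big_split/=; apply: eq_bigr => l _.
  by rewrite {1}(low_high y mu m) rmorphD/= mulrDl.
rewrite (eq_big_nat _ _ (F2 := fun n => (high y Lam n)%:C *
   (\sum_(1 <= m < N.+1) \sum_(1 <= l < N.+1) (low y mu m)%:C * psi (m * l * n)%N) +
   (high y Lam n)%:C * \sum_(1 <= k < N.+1)
     (\sum_(d <- divisors k) high y mu d)%:C * psi (k * n)%N)); last first.
  by move=> n nN; rewrite {1}(E n nN) mulrDr.
rewrite big_split/= addrA; congr (_ + _); last first.
  rewrite [RHS]exchange_big/=; apply: eq_bigr => n _; rewrite mulr_sumr.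
  by apply: eq_bigr => k _; rewrite rmorphM/=; ring.
have -> : \sum_(1 <= k < N.+1) \sum_(1 <= l < N.+1)
    (dconv (low y mu) (low y Lam) k)%:C * psi (k * l)%N =
   \sum_(1 <= m < N.+1) \sum_(1 <= n < N.+1) \sum_(1 <= l < N.+1)
    (low y mu m * low y Lam n)%:C * psi (m * n * l)%N.
  rewrite (eq_bigr (fun k => (dconv (low y mu) (low y Lam) k)%:C *
     \sum_(1 <= l < N.+1) psi (k * l)%N)); last by move=> k _; rewrite mulr_sumr.
  rewrite -(@sum_dconv _ _ (fun k => \sum_(1 <= l < N.+1) psi (k * l)%N)); last first.
    by move=> k Nk; rewrite big_nat big1// => l /andP[l0 _]; exact: psi0M.
  by apply: eq_bigr => m _; apply: eq_bigr => n _; rewrite mulr_sumr.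
apply/eqP; rewrite eq_sym subr_eq eq_sym; apply/eqP.
under eq_bigr do rewrite mulr_sumr.
rewrite exchange_big/= -big_split/=; apply: eq_big_nat => m /andP[m0 _].
transitivity ((low y mu m)%:C * \sum_(1 <= n < N.+1) \sum_(1 <= l < N.+1)
    (Lam n)%:C * psi (m * (n * l))%N).
  rewrite -big_split/= mulr_sumr; apply: eq_bigr => n _.
  rewrite !mulr_sumr -big_split/=; apply: eq_bigr => l _.
  rewrite [in RHS](low_high y Lam n) rmorphD rmorphM/= -[(m * l * n)%N]mulnA [(l * n)%N]mulnC.
  by rewrite -!mulnA; ring.
rewrite (@sum_divisors_psi Lam (fun k => psi (m * k)%N)); last first.
  by move=> k; rewrite mulnC; exact: psi0M.
rewrite mulr_sumr; apply: eq_big_nat => k /andP[k0 _].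
by rewrite dsum_mangoldt// rmorphM/=; ring.
Qed.

(** Bounding mu by 1 and removing the cuts leaves 1 * Lam = ln. *)
Lemma dconv_low_le y k : (0 < k <= N)%N ->
  `|dconv (low y mu) (low y Lam) k| <= ln k%:R.
Proof.
move=> k0N; have /andP[k0 kN] := k0N; rewrite -dsum_mangoldt// -(sum_dvdn _ k0N) /dconv.
rewrite (exchange_big_dep xpredT)//= [leRHS]big_mkcond/=.
apply: (le_trans (ler_norm_sum _ _ _)); apply: ler_sum_nat => n /andP[n0 nN].
apply: (le_trans (ler_norm_sum _ _ _)).
apply: (@le_trans _ _ (\sum_(1 <= m < N.+1 | k == (n * m)%N) Lam n)).
  rewrite (eq_bigl (fun m => k == (n * m)%N)); last by move=> m; rewrite mulnC.
  apply: ler_sum => m _; rewrite normrM -[leRHS]mul1r; apply: ler_pM => //.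
    by rewrite /low; case: ifP => _; rewrite ?normr0// mobius_le1.
  rewrite /low; case: ifP => _; rewrite ?normr0 ?mangoldt_ge0//.
  by rewrite ger0_norm// mangoldt_ge0.
by rewrite sum_mul_eq.
Qed.

Lemma dconv_low_eq0 y k f g : (y * y < k)%N -> dconv (low y f) (low y g) k = 0.
Proof.
move=> yk; rewrite /dconv big1// => m _; rewrite big1// => n /eqP kE.
rewrite /low; case: ifP => my; last by rewrite mul0r.
case: ifP => ny; last by rewrite mulr0.
by move: yk; rewrite kE ltnNge leq_mul.
Qed.

Lemma dsum_high_le y k : (0 < k)%N -> `|\sum_(d <- divisors k) high y mu d| <= tau R k.
Proof.
move=> k0; apply: (le_trans (ler_norm_sum _ _ _)).
rewrite /tau -sum1_size natr_sum; apply: ler_sum => d _.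
by rewrite /high; case: ifP => _; rewrite ?normr0// mobius_le1.
Qed.

Lemma dsum_high_eq0 y k f : (0 < k <= y)%N -> \sum_(d <- divisors k) high y f d = 0.
Proof.
move=> /andP[k0 ky]; rewrite big_seq big1// => d; rewrite -dvdn_divisors// => dk.
by rewrite /high (leq_trans (dvdn_leq k0 dk) ky).
Qed.

End Vaughan.

Lemma ln_nat_le (R : realType) n J : (0 < n)%N -> (n < 2 ^ J)%N -> 0 <= (ln n%:R : R) <= J%:R.
Proof.
move=> n0 nJ; rewrite ln_ge0 ?ler1n//=.
apply: (@le_trans _ _ (ln (2 ^ J)%:R)); first by rewrite ler_ln ?posrE ?ltr0n ?expn_gt0// ler_nat ltnW.
rewrite natrX lnXn// -[leRHS]mulr1 mulr_natl lerMn2r; apply/orP; right.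
have := @le_ln1Dx R 1; rewrite (_ : 1 + 1 = 2)//; apply; lra.
Qed.

Section Core.
Local Open Scope complex_scope.
Variables (R : realType) (al : R) (v : nat) (Q : pred nat) (H N : nat).
Hypotheses (v0 : (0 < v)%N) (Qv : forall n, Q (n + v)%N = Q n)
  (H0 : (0 < H)%N) (N0 : (0 < N)%N).
Variables (a : int) (q J : nat).
Hypotheses (aq : coprimez a q) (q2 : (2 <= q)%N)
  (baq : `|al * v%:R - a%:~R / q%:R| <= 1 / q%:R ^+ 2)
  (qJ : (2 * q <= 2 ^ J)%N) (J0 : (0 < J)%N) (HNJ : (H * N < 2 ^ J)%N).
Local Notation phase := (phase al Q N).
Local Notation majorant := (majorant R H N q).

(** In Vaughan's identity with y the cube root of N, the short sum is bounded trivially;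
    the sum with ln and the part k <= y of the following one have a long smooth variable;
    the part k > y and the last sum are bilinear with both factors below (y + 1) ^ 2. *)
Lemma mangoldt_sum_core x y : (x ^ 2 <= N < x.+1 ^ 2)%N -> (y ^ 3 <= N < y.+1 ^ 3)%N ->
  \sum_(1 <= h < H.+1) normc (\sum_(1 <= n < N.+1) (mangoldt R n)%:C * phase h n) <=
  (1 + 32 * v%:R + 4 * Num.sqrt (48 * v%:R)) * J%:R ^+ 7 *
    Num.sqrt (majorant x (y.+1 ^ 2)).
Proof.
move=> /andP[xN Nx] /andP[yN Ny].
have y0 : (0 < y)%N by rewrite lt0n; apply: contraTneq Ny => ->; rewrite exp1n -leqNgt.
have yleN : (y <= N)%N by apply: leq_trans yN; rewrite -{1}[y]expn1 leq_pexp2l.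
have yx : (y <= x)%N.
  rewrite -ltnS -(@ltn_exp2r _ _ 2)//; apply: leq_ltn_trans Nx.
  by apply: leq_trans yN; rewrite leq_pexp2l.
have xleN : (x <= N)%N by apply: leq_trans xN; case: (x) => // x'; rewrite -{1}[x'.+1]expn1 leq_pexp2l.
have NJ : (N < 2 ^ J)%N by apply: leq_ltn_trans HNJ; rewrite leq_pmull.
set Y := (y.+1 ^ 2)%N; set S := Num.sqrt (majorant x Y).
have S0 : 0 <= S by exact: sqrtr_ge0.
have J1 : 1 <= J%:R :> R by rewrite ler1n.
have big m n : (y < m)%N -> (Y <= n)%N -> (N < m * n)%N.
  by move=> ym Yn; apply: leq_trans Ny _; rewrite expnS leq_mul.
have lnJ n : (0 < n <= N)%N -> 0 <= (ln n%:R : R) <= J%:R.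
  by move=> /andP[n0 nN]; apply: ln_nat_le => //; exact: leq_ltn_trans NJ.
have LamJ n : (0 < n <= N)%N -> mangoldt R n <= J%:R.
  move=> n0N; have /andP[n0 _] := n0N; have /andP[_ h] := lnJ _ n0N.
  exact: le_trans (mangoldt_le_ln R n0) h.
pose mu := mobius R; pose Lam := mangoldt R.
pose w k := dconv N (low y mu) (low y Lam) k.
pose G k := \sum_(d <- divisors k) high y mu d.
have wJ k : (0 < k <= N)%N -> `|w k| <= J%:R.
  move=> k0N; apply: le_trans (dconv_low_le R y k0N) _.
  by have /andP[] := lnJ _ k0N.
have w0 k : (Y <= k)%N -> w k = 0.
  move=> Yk; apply: dconv_low_eq0; apply: leq_trans Yk.
  by rewrite /Y expnS expn1 ltn_mul.
(* With Y = (y + 1) ^ 2, a product of two factors, one above y and the other at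
   least Y, exceeds N; so T3 and T4, where one factor exceeds y, may be cut at Y. *)
pose T0 h := \sum_(1 <= n < N.+1) (low y Lam n)%:C * phase h n.
pose T1 h := \sum_(1 <= m < y.+1) \sum_(1 <= n < N.+1) (mu m * ln n%:R)%:C * phase h (m * n).
pose T2 h := \sum_(1 <= k < y.+1) \sum_(1 <= l < N.+1) (w k * 1)%:C * phase h (k * l).
pose f3 l : R := if (l < Y)%N then 1 else 0.
pose g3 k : R := if (y < k)%N then w k else 0.
pose T3 h := \sum_(1 <= l < N.+1) \sum_(1 <= k < N.+1) (f3 l * g3 k)%:C * phase h (l * k).
pose f4 k : R := if (k < Y)%N then G k else 0.
pose g4 n : R := if (n < Y)%N then high y Lam n else 0.
pose T4 h := \sum_(1 <= k < N.+1) \sum_(1 <= n < N.+1) (f4 k * g4 n)%:C * phase h (k * n).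
have low_restrict (F : nat -> R[i]) : (forall m, (y < m)%N -> F m = 0) ->
    \sum_(1 <= m < N.+1) F m = \sum_(1 <= m < y.+1) F m.
  move=> F0; rewrite (big_cat_nat (n := y.+1))//= [X in _ + X]big_nat [X in _ + X]big1 ?addr0//.
  by move=> m /andP[ym _]; exact: F0.
have decomp h : \sum_(1 <= n < N.+1) (Lam n)%:C * phase h n =
    T0 h + T1 h - (T2 h + T3 h) + T4 h.
  rewrite (vaughan N0 y); last by move=> k; exact: phase0.
  congr (_ + _ - _ + _).
  - rewrite low_restrict => [|m ym]; last first.
      by rewrite big1// => n _; rewrite /low leqNgt ym/= mul0r mul0r.
    by apply: eq_big_nat => m /andP[_ my]; apply: eq_bigr => n _; rewrite /low -ltnS my.
  - rewrite (big_cat_nat (n := y.+1))//=; congr (_ + _).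
      by apply: eq_bigr => k _; apply: eq_bigr => l _; rewrite mulr1.
    rewrite /T3 [RHS]exchange_big/= [RHS](big_cat_nat (n := y.+1))//=.
    rewrite [X in _ = X + _]big_nat [X in _ = X + _]big1 ?add0r; last first.
      by move=> k /andP[_ ky]; rewrite big1// => l _; rewrite /g3 (_ : (y < k)%N = false) ?mulr0 ?mul0r//; lia.
    apply: eq_big_nat => k /andP[yk kN]; apply: eq_big_nat => l /andP[l0 lN].
    rewrite /g3 yk /f3 mulnC; case: (ltnP l Y) => [_|Yl]; first by rewrite mul1r.
    by rewrite phase0 ?mulr0// mulnC big.
  apply: eq_big_nat => k /andP[k0 kN]; apply: eq_big_nat => n /andP[n0 nN].
  have [ny|yn] := leqP n y.
    by rewrite /g4 /high ny if_same !mulr0.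
  rewrite /f4 /g4 /high leqNgt yn/=.
  have [Yk|kY] := leqP Y k.
    by rewrite phase0 ?mulr0// mulnC big.
  have [Yn|nY] := leqP Y n => //.
  have [ky|yk] := leqP k y; last by rewrite phase0 ?mulr0//; exact: big.
  by rewrite /G dsum_high_eq0 ?k0// !mul0r.
apply: (@le_trans _ _ (\sum_(1 <= h < H.+1) normc (T0 h) + \sum_(1 <= h < H.+1) normc (T1 h)
  + (\sum_(1 <= h < H.+1) normc (T2 h) + \sum_(1 <= h < H.+1) normc (T3 h))
  + \sum_(1 <= h < H.+1) normc (T4 h))).
  rewrite -!big_split/=; apply: ler_sum => h _; rewrite decomp.
  apply: (le_trans (le_normcD _ _)); rewrite lerD2r.
  apply: (le_trans (le_normcD _ _)); rewrite normcN.
  by apply: lerD; exact: le_normcD.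
have JS i : (i <= 7)%N -> J%:R ^+ i * S <= J%:R ^+ 7 * S.
  by move=> i7; rewrite ler_wpM2r// ler_weXn2l.
have b0 : \sum_(1 <= h < H.+1) normc (T0 h) <= J%:R ^+ 7 * S.
  apply: le_trans (JS 1%N isT).
  apply: (@le_trans _ _ (\sum_(1 <= h < H.+1) \sum_(1 <= n < y.+1) J%:R)).
    apply: ler_sum => h _; rewrite /T0 low_restrict; last first.
      by move=> m ym; rewrite /low leqNgt ym/= mul0r.
    apply: (le_trans (normc_sum _ _ _)); apply: ler_sum_nat => n /andP[n0 ny].
    rewrite Normc.normcM normc_real /low -ltnS ny -[leRHS]mulr1.
    apply: ler_pM; rewrite ?normc_ge0//.
      rewrite ger0_norm ?mangoldt_ge0// LamJ// n0/=.
      by rewrite -ltnS in ny; exact: leq_trans yleN.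
    by rewrite /phase; case: ifP => _; rewrite ?Normc.normc0// normc_e.
  rewrite !sum_const_nat !subn1/= mulrA mulrC expr1 ler_wpM2l//.
  apply: le_sqrt_sq; first by rewrite mulr_ge0.
  apply: (@le_trans _ _ (H%:R ^+ 2 * N%:R * x%:R)).
    by rewrite exprMn -[leRHS]mulrA ler_wpM2l ?sqr_ge0// expr2 -!natrM ler_nat leq_mul.
  have a1 : 0 <= (H * N)%:R ^+ 2 / q%:R :> R by rewrite divr_ge0 ?sqr_ge0.
  have a2 : 0 <= (H * N)%:R * Y%:R :> R by rewrite mulr_ge0.
  have a3 : 0 <= (H * N)%:R * q%:R :> R by rewrite mulr_ge0.
  by rewrite /majorant; lra.
have b1 : \sum_(1 <= h < H.+1) normc (T1 h) <= 16 * v%:R * (J%:R ^+ 7 * S).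
  have ub := @typeI_sum _ al _ _ H N v0 Qv _ _ _ aq q2 baq qJ J0 HNJ mu (fun n => ln n%:R)
    1 J%:R x y Y yx yleN ler01 (ler0n _ _).
  apply: le_trans (ub _ _) _.
  - by move=> m _; exact: mobius_le1.
  - move=> z C hC; apply: le_trans (sum_ln_weight_le N0 hC) _.
    have C0 : 0 <= C by apply: le_trans (hC 1%N isT); exact: normc_ge0.
    have /andP[_ h] : 0 <= (ln N%:R : R) <= J%:R by apply: lnJ; rewrite N0 leqnn.
    by rewrite ler_wpM2r.
  rewrite [leLHS](_ : _ = 16 * v%:R * (J%:R ^+ 4 * S)); last by rewrite /S; ring.
  by rewrite ler_wpM2l ?mulr_ge0// JS.
have b2 : \sum_(1 <= h < H.+1) normc (T2 h) <= 16 * v%:R * (J%:R ^+ 7 * S).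
  have ub := @typeI_sum _ al _ _ H N v0 Qv _ _ _ aq q2 baq qJ J0 HNJ w (fun=> 1)
    J%:R 1 x y Y yx yleN (ler0n _ _) ler01.
  apply: le_trans (ub _ _) _.
  - by move=> k /andP[k0 ky]; rewrite wJ// k0 (leq_trans ky).
  - move=> z C hC; rewrite mul1r.
    by under eq_bigr do rewrite mul1r; exact: hC.
  rewrite [leLHS](_ : _ = 16 * v%:R * (J%:R ^+ 4 * S)); last by rewrite /S; ring.
  by rewrite ler_wpM2l ?mulr_ge0// JS.
have sqrt48 : Num.sqrt (48 * v%:R * majorant x Y) = Num.sqrt (48 * v%:R) * S.
  by rewrite /S -sqrtrM ?mulr_ge0.
have b3 : \sum_(1 <= h < H.+1) normc (T3 h) <= 2 * Num.sqrt (48 * v%:R) * (J%:R ^+ 7 * S).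
  have ub := @typeII_sum _ al _ _ H N v0 Qv _ _ _ aq q2 baq qJ J0 NJ f3 g3 x Y Nx xleN.
  apply: le_trans (ub _ _ _ _) _.
  - by move=> m m0; rewrite /f3; case: ifP => _; rewrite ?normr1 ?normr0 ?tau_ge1 ?tau_ge0.
  - by move=> n nN; rewrite /g3; case: ifP => _; rewrite ?normr0// wJ.
  - by move=> m Ym; rewrite /f3 ltnNge Ym.
  - by move=> n Yn; rewrite /g3 w0//; case: ifP.
  by rewrite sqrt48 le_eqVlt; apply/orP; left; apply/eqP; ring.
have b4 : \sum_(1 <= h < H.+1) normc (T4 h) <= 2 * Num.sqrt (48 * v%:R) * (J%:R ^+ 7 * S).
  have ub := @typeII_sum _ al _ _ H N v0 Qv _ _ _ aq q2 baq qJ J0 NJ f4 g4 x Y Nx xleN.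
  apply: le_trans (ub _ _ _ _) _.
  - move=> m m0; rewrite /f4; case: ifP => _; last by rewrite normr0 tau_ge0.
    exact: dsum_high_le.
  - move=> n nN; rewrite /g4; case: ifP => _; last by rewrite normr0.
    rewrite /high; case: ifP => _; first by rewrite normr0.
    by rewrite ger0_norm ?mangoldt_ge0// LamJ.
  - by move=> m Ym; rewrite /f4 ltnNge Ym.
  - by move=> n Yn; rewrite /g4 ltnNge Yn.
  by rewrite sqrt48 le_eqVlt; apply/orP; left; apply/eqP; ring.
rewrite [leRHS](_ : _ = J%:R ^+ 7 * S + 16 * v%:R * (J%:R ^+ 7 * S)
  + (16 * v%:R * (J%:R ^+ 7 * S) + 2 * Num.sqrt (48 * v%:R) * (J%:R ^+ 7 * S))
  + 2 * Num.sqrt (48 * v%:R) * (J%:R ^+ 7 * S)); last by rewrite /S; ring.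
by rewrite !lerD.
Qed.

End Core.

(** * Real powers and the theorem *)

Lemma exists_root_nat k N : (0 < k)%N -> exists x, (x ^ k <= N < x.+1 ^ k)%N.
Proof.
move=> k0; have ex : exists x, (x ^ k <= N)%N by exists 0%N; rewrite exp0n.
have ub x : (x ^ k <= N)%N -> (x <= N)%N.
  apply: leq_trans; case: x => // x.
  by rewrite -{1}[x.+1]expn1 leq_pexp2l.
case: (ex_maxnP ex ub) => x xN max; exists x; rewrite xN/= ltnNge.
by apply/negP => /max; rewrite ltnn.
Qed.

Section Final.
Variable R : realType.

Lemma sqr_powR (a r : R) : (a `^ r) ^+ 2 = a `^ (r * 2).
Proof. by rewrite powRrM powR_mulrn ?powR_ge0. Qed.

(** x is at most the square root of N and (y + 1) ^ 2 <= 4 y ^ 2 <= 4 N ^ (2 / 3). *)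
Lemma majorant_le (H N : nat) (h n : R) (q x y : nat) :
  (0 < N)%N -> (0 < q)%N -> H%:R <= h -> N%:R <= n ->
  (x ^ 2 <= N)%N -> (y ^ 3 <= N)%N -> (0 < y)%N ->
  majorant R H N q x (y.+1 ^ 2) <=
  4 * ((h * n * q%:R `^ (- (1 / 2))) ^+ 2 + (h * n `^ (3 / 4)) ^+ 2 +
       (h `^ (1 / 2) * n `^ (5 / 6)) ^+ 2 + ((h * n * q%:R) `^ (1 / 2)) ^+ 2).
Proof.
move=> N0 q0 Hh Nn xN yN y0.
have h0 : 0 <= h by apply: le_trans Hh.
have n1 : 1 <= n by apply: le_trans Nn; rewrite ler1n.
have n0 : 0 < n by lra.
have q0R : 0 < q%:R :> R by rewrite ltr0n.
have HN : (H * N)%:R <= h * n by rewrite natrM; apply: ler_pM.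
have hn0 : 0 <= h * n by rewrite mulr_ge0// ltW.
have powR1D (r : R) : n `^ (1 + r) = n * n `^ r.
  by rewrite powRD ?powRr1 ?(ltW n0)//; apply/implyP => _; rewrite gt_eqF.
have -> : (h * n * q%:R `^ (- (1 / 2))) ^+ 2 = (h * n) ^+ 2 / q%:R.
  rewrite exprMn sqr_powR (_ : - (1 / 2) * 2 = - 1 :> R); last by field.
  by rewrite powR_inv1// ltW.
have -> : (h * n `^ (3 / 4)) ^+ 2 = h ^+ 2 * (n * n `^ (1 / 2)).
  rewrite exprMn sqr_powR -powR1D; congr (_ * _ `^ _); by field.
have -> : (h `^ (1 / 2) * n `^ (5 / 6)) ^+ 2 = h * (n * n `^ (2 / 3)).
  rewrite exprMn !sqr_powR -powR1D (_ : 1 / 2 * 2 = 1 :> R); last by field.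
  rewrite powRr1//; congr (_ * _ `^ _); by field.
have -> : ((h * n * q%:R) `^ (1 / 2)) ^+ 2 = h * n * q%:R.
  rewrite sqr_powR (_ : 1 / 2 * 2 = 1 :> R); last by field.
  by rewrite powRr1// mulr_ge0// ltW.
have xn : x%:R <= n `^ (1 / 2).
  have -> : x%:R = (x%:R ^+ 2) `^ (1 / 2) :> R.
    rewrite -powR_mulrn// -powRrM (_ : 2 * (1 / 2) = 1 :> R); last by field.
    by rewrite powRr1.
  apply: ge0_ler_powR; rewrite ?nnegrE ?sqr_ge0 ?(ltW n0)//.
  by apply: le_trans Nn; rewrite -natrX ler_nat.
have yn : (y.+1 ^ 2)%:R <= 4 * n `^ (2 / 3).
  apply: (@le_trans _ _ (4 * (y ^ 2)%:R)).
    by rewrite -natrM ler_nat; nia.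
  rewrite ler_wpM2l//.
  have -> : (y ^ 2)%:R = (y%:R ^+ 3) `^ (2 / 3) :> R.
    rewrite -powR_mulrn// -powRrM (_ : 3 * (2 / 3) = 2 :> R); last by field.
    by rewrite powR_mulrn// natrX.
  apply: ge0_ler_powR; rewrite ?nnegrE ?exprn_ge0 ?(ltW n0)//.
  by apply: le_trans Nn; rewrite -natrX ler_nat.
have p1 : (H * N)%:R ^+ 2 / q%:R <= (h * n) ^+ 2 / q%:R.
  by rewrite ler_wpM2r ?invr_ge0 ?(ltW q0R)// lerXn2r ?nnegrE.
have p2 : H%:R ^+ 2 * N%:R * x%:R <= h ^+ 2 * (n * n `^ (1 / 2)).
  rewrite -mulrA; apply: ler_pM; rewrite ?sqr_ge0 ?mulr_ge0//.
    by rewrite lerXn2r ?nnegrE.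
  by apply: ler_pM.
have p3 : (H * N)%:R * (y.+1 ^ 2)%:R <= 4 * (h * (n * n `^ (2 / 3))).
  apply: (@le_trans _ _ (h * n * (4 * n `^ (2 / 3)))); first by apply: ler_pM.
  by rewrite le_eqVlt; apply/orP; left; apply/eqP; ring.
have p4 : (H * N)%:R * q%:R <= h * n * q%:R by rewrite ler_wpM2r// ltW.
have z1 : 0 <= (h * n) ^+ 2 / q%:R by rewrite divr_ge0 ?sqr_ge0// ltW.
have z2 : 0 <= h ^+ 2 * (n * n `^ (1 / 2)) by rewrite !mulr_ge0 ?sqr_ge0 ?powR_ge0// ltW.
have z4 : 0 <= h * n * q%:R by rewrite mulr_ge0// ltW.
rewrite /majorant; lra.
Qed.

(** J is a binary length of H N, so it is at most a constant times ln (2 H N); the factor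
    2 keeps this true when H N = 1. *)
Lemma dyadic_length (H N : nat) (h n : R) :
  (0 < H)%N -> (0 < N)%N -> H%:R <= h -> N%:R <= n ->
  exists J, [/\ (0 < J)%N, (2 * (H * N) <= 2 ^ J)%N, (H * N < 2 ^ J)%N &
    J%:R <= 2 / ln 2 * ln (2 * h * n)].
Proof.
move=> H0 N0 Hh Nn; have HN0 : (0 < H * N)%N by rewrite muln_gt0 H0.
have /andP[t1 t2] := trunc_log_bounds (isT : (1 < 2)%N) HN0.
set t := trunc_log 2 (H * N) in t1 t2.
exists t.+2; split=> //.
- by rewrite expnS leq_mul2l ltnW.
- by apply: leq_trans t2 _; rewrite leq_exp2l.
have ln2 : 0 < ln 2 :> R by rewrite ln_gt0// ltr1n.
rewrite mulrAC ler_pdivlMr//.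
have HNh : (H * N)%:R <= h * n by rewrite natrM; apply: ler_pM.
have HN1 : 1 <= (H * N)%:R :> R by rewrite ler1n.
have hn : 0 < h * n by lra.
have l1 : ln (2 * h * n) = ln 2 + ln (h * n) by rewrite -mulrA lnM ?posrE.
have l2 : t%:R * ln 2 <= ln (h * n).
  rewrite mulr_natl -lnXn// ler_ln ?posrE ?exprn_gt0//.
  by apply: le_trans HNh; rewrite -natrX ler_nat.
have l3 : 0 <= ln (h * n) by rewrite ln_ge0//; lra.
rewrite l1 -addn2 natrD mulrDl; lra.
Qed.

(** Needed when q > H N, where the term (H N q) ^ (1 / 2) is already at least H N. *)
Lemma mangoldt_sum_trivial (al : R) (Q : pred nat) (H N J : nat) :
  (0 < N)%N -> (N < 2 ^ J)%N ->
  \sum_(1 <= h < H.+1) normc (\sum_(1 <= n < N.+1)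
     (mangoldt R n)%:C%C * phase al Q N h n) <= (H * N)%:R * J%:R.
Proof.
move=> N0 NJ.
apply: (@le_trans _ _ (\sum_(1 <= h < H.+1) \sum_(1 <= n < N.+1) J%:R)).
  apply: ler_sum => h _; apply: (le_trans (normc_sum _ _ _)).
  apply: ler_sum_nat => n /andP[n0 nN].
  rewrite Normc.normcM normc_real -[leRHS]mulr1; apply: ler_pM; rewrite ?normc_ge0//.
    rewrite ger0_norm ?mangoldt_ge0//; apply: le_trans (mangoldt_le_ln R n0) _.
    by have /andP[] := @ln_nat_le R _ _ n0 (leq_ltn_trans (nN : (n <= N)%N) NJ).
  by rewrite /phase; case: ifP => _; rewrite ?Normc.normc0// normc_e.
by rewrite !sum_const_nat !subn1/= natrM mulrA.
Qed.

End Final.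

Theorem theorem3 (R : realType) (v : nat) (eps : R) (v_ge1 : (1 <= v)%N)
    (eps_gt0 : 0 < eps) :
  exists C : R, 0 < C /\
    forall (u : nat) (alpha H N : R) (a q : int),
      (1 <= u)%N -> coprime u v ->
      irrational alpha ->
      1 <= H -> 1 <= N ->
      coprimez a q ->
      N `^ (1 / 4) < q%:~R ->
      `|alpha * v%:R - a%:~R / q%:~R| <= 1 / q%:~R ^+ 2 ->
      \sum_(1 <= h < (Num.truncn H).+1)
         Normc.normc (\sum_(1 <= n < (Num.truncn N).+1 | n == u %[mod v])
                  (mangoldt R n)%:C%C * e (alpha * h%:R * n%:R))
      <= C * ln (2 * H * N) ^+ 7 *
         (H * N * q%:~R `^ (- (1 / 2)) + H * N `^ (3 / 4)
          + H `^ (1 / 2) * N `^ (5 / 6) + (H * N * q%:~R) `^ (1 / 2)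
          + (H * N) `^ eps * q%:~R).
Proof.
pose C0 : R := 1 + 32 * v%:R + 4 * Num.sqrt (48 * v%:R).
have ln2 : 0 < ln 2 :> R by rewrite ln_gt0// ltr1n.
have C01 : 1 <= C0.
  by rewrite /C0 -addrA lerDl addr_ge0 ?mulr_ge0// sqrtr_ge0.
have C00 : 0 <= C0 by exact: le_trans ler01 C01.
(* 2 is the root of the 4 in [majorant_le]; 2 / ln 2 turns J into ln (2 H N) *)
exists (2 * C0 * (2 / ln 2) ^+ 7); split.
  apply: mulr_gt0; last by rewrite exprn_gt0// divr_gt0.
  by apply: mulr_gt0 => //; lra.
move=> u alpha H N a q _ _ _ H1 N1 aq Nq baq.
have q1 : 1 < q%:~R :> R.
  have p1 : 1 `^ (1 / 4) <= N `^ (1 / 4) :> R.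
    by apply: ge0_ler_powR; rewrite ?nnegrE//; lra.
  by move: p1; rewrite powR1 => p1; exact: le_lt_trans p1 Nq.
have [q' qE q2] : exists2 q' : nat, q = q' & (2 <= q')%N.
  move: q1; rewrite ltr1z => q1; exists `|q|%N; lia.
move: aq baq; rewrite {}qE in q1 *; rewrite -!pmulrn => aq baq.
set H' := Num.truncn H; set N' := Num.truncn N.
have H'0 : (0 < H')%N by rewrite truncn_gt0.
have N'0 : (0 < N')%N by rewrite truncn_gt0.
have HH : H'%:R <= H by rewrite truncn_le; lra.
have NN : N'%:R <= N by rewrite truncn_le; lra.
pose Q n := n == u %[mod v].
have Qv n : Q (n + v)%N = Q n by rewrite /Q modnDr.
have -> : \sum_(1 <= h < H'.+1) normc (\sum_(1 <= n < N'.+1 | n == u %[mod v])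
      (mangoldt R n)%:C%C * e (alpha * h%:R * n%:R)) =
   \sum_(1 <= h < H'.+1) normc (\sum_(1 <= n < N'.+1)
      (mangoldt R n)%:C%C * phase alpha Q N' h n).
  apply: eq_bigr => h _; congr normc; rewrite big_mkcond/=.
  apply: eq_big_nat => n /andP[_ nN]; rewrite /phase -ltnS nN/= -/(Q n).
  by case: ifP; rewrite ?mulr0.
have [J [J0 HNJ2 HNJ JL]] := dyadic_length H'0 N'0 HH NN.
have J1 : 1 <= J%:R :> R by rewrite ler1n.
set A := H * N * _; set B := H * N `^ _; set D := H `^ _ * _.
set E := (H * N * q'%:R) `^ _; set F := (H * N) `^ eps * _.
have A0 : 0 <= A by rewrite /A !mulr_ge0 ?powR_ge0//; lra.
have B0 : 0 <= B by rewrite /B !mulr_ge0 ?powR_ge0//; lra.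
have D0 : 0 <= D by rewrite /D !mulr_ge0 ?powR_ge0//; lra.
have E0 : 0 <= E by rewrite /E powR_ge0.
have F0 : 0 <= F by rewrite /F !mulr_ge0 ?powR_ge0//; lra.
suff main : \sum_(1 <= h < H'.+1) normc (\sum_(1 <= n < N'.+1)
      (mangoldt R n)%:C%C * phase alpha Q N' h n) <=
    2 * C0 * J%:R ^+ 7 * (A + B + D + E + F).
  apply: (le_trans main); rewrite ler_wpM2r//; first lra.
  rewrite -[leRHS]mulrA -exprMn ler_wpM2l//; first lra.
  rewrite lerXn2r ?nnegrE//; exact: le_trans JL.
have [qHN|HNq] := leqP q' (H' * N').
  have [x /andP[xN Nx]] := @exists_root_nat 2 N' isT.
  have [y /andP[yN Ny]] := @exists_root_nat 3 N' isT.
  have y0 : (0 < y)%N by rewrite lt0n; apply: contraTneq Ny => ->; rewrite exp1n -leqNgt.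
  have qJ : (2 * q' <= 2 ^ J)%N by apply: leq_trans HNJ2; rewrite leq_mul2l.
  have core := @mangoldt_sum_core R alpha v Q H' N' v_ge1 Qv H'0 N'0 a q' J aq q2 baq qJ J0 HNJ
    x y.
  apply: (le_trans (core _ _)); rewrite ?xN ?yN//.
  rewrite [leRHS](_ : _ = C0 * J%:R ^+ 7 * (2 * (A + B + D + E + F))); last by ring.
  apply: ler_wpM2l; first by apply: mulr_ge0; rewrite ?exprn_ge0.
  have S0 : 0 <= 2 * (A + B + D + E + F) by lra.
  rewrite -[leRHS]ger0_norm// -sqrtr_sqr ler_wsqrtr//.
  apply: (le_trans (majorant_le N'0 (ltnW q2) HH NN xN yN y0)).
  rewrite -/A -/B -/D -/E.
  have AB : 0 <= A * (B + D + E + F) by rewrite mulr_ge0// !addr_ge0.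
  have BD : 0 <= B * (D + E + F) by rewrite mulr_ge0// !addr_ge0.
  have DE : 0 <= D * (E + F) by rewrite mulr_ge0// !addr_ge0.
  have EF : 0 <= E * F by rewrite mulr_ge0.
  have FF : 0 <= F ^+ 2 by rewrite sqr_ge0.
  clearbody A B D E F.
  clear -AB BD DE EF FF; lra.
have NJ : (N' < 2 ^ J)%N by apply: leq_ltn_trans HNJ; rewrite leq_pmull.
apply: (le_trans (mangoldt_sum_trivial alpha Q H' N'0 NJ)).
have HNE : (H' * N')%:R <= E.
  have HN : (H' * N')%:R <= H * N by rewrite natrM; apply: ler_pM.
  have -> : (H' * N')%:R = ((H' * N')%:R ^+ 2) `^ (1 / 2) :> R.
    rewrite -powR_mulrn// -powRrM (_ : 2 * (1 / 2) = 1 :> R); last by field.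
    by rewrite powRr1.
  apply: ge0_ler_powR; rewrite ?nnegrE ?sqr_ge0 ?mulr_ge0//; [lra..|].
  by rewrite expr2; apply: ler_pM => //; rewrite ler_nat ltnW.
have J7 : J%:R <= J%:R ^+ 7 :> R by rewrite -{1}[J%:R]expr1 ler_weXn2l.
apply: (@le_trans _ _ (E * J%:R ^+ 7)); first by apply: ler_pM.
rewrite mulrC [leRHS](_ : _ = J%:R ^+ 7 * (2 * C0 * (A + B + D + E + F))); last by ring.
rewrite ler_wpM2l ?exprn_ge0//.
by apply: (@le_trans _ _ (1 * (A + B + D + E + F))); [lra|rewrite ler_wpM2r//; lra].
Qed.
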